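(* Let $\mathcal{F}_1\subset\mathcal{F}_2\subset\cdots\subset\mathcal{F}$. There exists a choice of numerical constants $\bar c,\hat c>0$ and a constant $C>0$ such that the following holds for any sequence $\{t_k\}$ with $t_k>0$. Suppose $\hat\delta_n(\mathcal{F}_k;t_k)$ (data-dependent) and $\tilde\delta_n(\mathcal{F}_k;t_k)$ (distribution-dependent, nonrandom), $k\ge1$, satisfy $$\mathbb{P}\{\bar\delta_n(\mathcal{F}_k;t_k)\le\hat\delta_n(\mathcal{F}_k;t_k)\le\tilde\delta_n(\mathcal{F}_k;t_k)\}\ge1-p_k\quad\text{for all }k.$$ Put $\bar\delta_n(k):=\max_{1\le j\le k}\bar\delta_n(\mathcal{F}_j;t_j)$, $\hat\delta_n(k):=\max_{1\le j\le k}\hat\delta_n(\mathcal{F}_j;t_j)$, $\tilde\delta_n(k):=\max_{1\le j\le k}\tilde\delta_n(\mathcal{F}_j;t_j)$, and $$k^*(P):=\inf\Big\{k:\forall l>k\ \inf_{\mathcal{F}_k}Pf=\inf_{\mathcal{F}_l}Pf\Big\},\qquad\bar k(P):=\inf\Big\{k:\forall l>k\ \inf_{\mathcal{F}_k}Pf-\inf_{\mathcal{F}_l}Pf\le\bar c\,\bar\delta_n(l)\Big\},$$ $$\hat k:=\inf\Big\{k:\forall l>k\ \inf_{\mathcal{F}_k}P_nf-\inf_{\mathcal{F}_l}P_nf\le\hat c\,\hat\delta_n(l)\Big\},\qquad\hat f:=\hat f_{n,\hat k}.$$ Then $$\mathbb{P}\Big\{P\hat f-\inf_k\inf_{\mathcal{F}_k}Pf\ge\inf_{k\ge\bar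 k(P)}\Big[\inf_{\mathcal{F}_k}Pf-\inf_j\inf_{\mathcal{F}_j}Pf+C\tilde\delta_n(k)\Big]\Big\}\le\sum_{k=1}^\infty\Big(p_k+\Big(\log_q\frac{q^2n}{t_k}\Big)_+e^{-t_k}\Big).$$ In particular, if $k^*(P)<\infty$, then $$\mathbb{P}\Big\{P\hat f-\inf_k\inf_{\mathcal{F}_k}Pf\ge C\tilde\delta_n(k^*(P))\Big\}\le\sum_{k=1}^\infty\Big(p_k+\Big(\log_q\frac{q^2n}{t_k}\Big)_+e^{-t_k}\Big).$$
   Context: $(S,\mathcal{A},P)$ is a probability space, $\mathcal{F}$ is a class of measurable functions $f:S\to[0,1]$, $X_1,\dots,X_n$ are i.i.d. with distribution $P$, $P_n$ is the empirical measure. $\hat f_{n,k}$ is a minimizer of $P_nf$ over $\mathcal{F}_k$ (assumed to exist); measurability of suprema over function classes is assumed. The infimum of an empty set of indices is $\infty$; if $\hat k=\infty$, $\hat f$ is defined arbitrarily (say $\hat f=\hat f_{n,1}$); if $\bar k(P)=\infty$, the infimum over $k\ge\bar k(P)$ is taken to be $1$ (which is intended to make the first bound trivial). $(x)_+:=\max(x,0)$. $q>1$ is fixed (numerical constants may depend on it), $\delta_j:=q^{-j}$, $j\in\mathbb{Z}$; for $\psi:\mathbb{R}_+\to\mathbb{R}_+$, $\psi^{\flat,q}(\delta):=\sup_{j:\,\delta_j\ge\delta}\psi(\delta_j)/\delta_j$ and $\psi^{\sharp,q}(\varepsilon):=\inf\{\delta>0:\psi^{\flat,q}(\delta)\le\varepsilon\}$.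 $\rho_P:L_2(P)\times L_2(P)\to[0,\infty)$ is a fixed function with $\rho_P^2(f,g)\ge P(f-g)^2-(P(f-g))^2$ (e.g. $\rho_P^2(f,g)=P(f-g)^2$). For $\mathcal{G}\subset\mathcal{F}$: $\mathcal{G}(\delta):=\{f\in\mathcal{G}:Pf-\inf_{\mathcal{G}}Pg\le\delta\}$, $D_P(\mathcal{G};\delta):=\sup_{f,g\in\mathcal{G}(\delta)}\rho_P(f,g)$, $\phi_n(\mathcal{G};\delta):=\mathbb{E}\sup_{f,g\in\mathcal{G}(\delta)}|(P_n-P)(f-g)|$, $\bar U_{n,t}(\delta):=2\big(\phi_n(\mathcal{G};\delta)+D_P(\mathcal{G};\delta)\sqrt{t/n}+t/n\big)$ and $\bar\delta_n(\mathcal{G};t):=\bar U_{n,t}^{\sharp,q}(\frac1{2q^3})$. *)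

(* Defs.v *)
From HB Require Import structures.
From mathcomp Require Export all_boot all_order all_algebra.
From mathcomp Require Export all_classical all_reals all_analysis.
From mathcomp Require Export measurable_realfun.

Set Implicit Arguments.
Unset Strict Implicit.
Unset Printing Implicit Defensive.
Import Order.TTheory GRing.Theory Num.Theory.
Import numFieldNormedType.Exports.

Local Open Scope classical_set_scope.
Local Open Scope ring_scope.

(* Infimum of a set of indices; [None] stands for the infimum of the empty
   set, i.e. for the index infinity. *)
Definition index_inf (A : set nat) : option nat :=
  match pselect (exists k, `[< A k >]) with
  | left exA => Some (ex_minn exA)
  | right _ => None
  end.

Definition max_upto (R : realType) (u : nat -> \bar R) (k : nat) : \bar R :=
  \big[maxe/-oo%E]_(1 <= j < k.+1) u j.

Section QTransforms.
Context (R : realType) (q : R).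

Definition flat_transform (psi : R -> \bar R) (delta : R) : \bar R :=
  ereal_sup [set (psi (q ^ (- j)) * ((q ^ (- j))^-1)%:E)%E |
             j in [set j : int | delta <= q ^ (- j)]].

Definition sharp_transform (psi : R -> \bar R) (eps : R) : \bar R :=
  ereal_inf [set delta%:E |
    delta in [set delta | 0 < delta /\ (flat_transform psi delta <= eps%:E)%E]].

End QTransforms.

Section RiskMinimization.
Context (R : realType) (d d' : measure_display).
Context (S : measurableType d) (P : probability S R).
Context (Omega : measurableType d') (Pr : probability Omega R).
Implicit Types (G : set (S -> R)) (f g : S -> R) (rho : (S -> R) -> (S -> R) -> R).

Definition mutually_independent n (X : 'I_n -> {mfun Omega >-> S}) : Prop :=
  forall (J : {set 'I_n}) (A : 'I_n -> set S),
    (forall i, i \in J -> measurable (A i)) ->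
    (Pr (\bigcap_(i in [set` J]) (X i @^-1` A i)) =
     \prod_(i in J) Pr (X i @^-1` A i))%E.

Definition iid_sample n (X : 'I_n -> {mfun Omega >-> S}) : Prop :=
  (forall i (A : set S), measurable A -> distribution Pr (X i) A = P A) /\
  mutually_independent X.

Definition mean f : R := \int[P]_x f x.

Definition emp_mean n (X : 'I_n -> {mfun Omega >-> S}) (w : Omega) f : R :=
  n%:R^-1 * \sum_(i < n) f (X i w).

(* A function on representatives: invariance under almost sure equality is not
   required. *)
Definition dominates_variance rho : Prop :=
  forall f g, f \in Lfun P 2%:E -> g \in Lfun P 2%:E ->
    0 <= rho f g /\
    mean (fun x => (f x - g x) ^+ 2) - mean (fun x => f x - g x) ^+ 2
      <= rho f g ^+ 2.

Definition inf_mean G : R := inf [set mean f | f in G].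

Definition inf_emp_mean n (X : 'I_n -> {mfun Omega >-> S}) G (w : Omega) : R :=
  inf [set emp_mean X w f | f in G].

Definition near_min G (delta : R) : set (S -> R) :=
  [set f | G f /\ mean f - inf_mean G <= delta].

(* Takes the value +oo when [rho] is unbounded on the delta-minimal set. *)
Definition diam rho G (delta : R) : \bar R :=
  ereal_sup [set (rho f g)%:E | f in near_min G delta & g in near_min G delta].

Definition phi n (X : 'I_n -> {mfun Omega >-> S}) G (delta : R) : \bar R :=
  (\int[Pr]_w ereal_sup
     [set `|emp_mean X w (f \- g) - mean (f \- g)|%:E |
      f in near_min G delta & g in near_min G delta])%E.

Definition Ubar n (X : 'I_n -> {mfun Omega >-> S}) rho G (t delta : R) : \bar R :=
  (2%:E * (phi X G delta + diam rho G delta * (Num.sqrt (t / n%:R))%:E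
           + (t / n%:R)%:E))%E.

Definition delta_bar (q : R) n (X : 'I_n -> {mfun Omega >-> S}) rho G (t : R)
    : \bar R :=
  sharp_transform q (Ubar X rho G t) (2 * q ^+ 3)^-1.

Definition sup_process n G (e : 'I_n -> R) (x : n.-tuple S) : \bar R :=
  ereal_sup
    [set `|\sum_(i < n) e i * ((f \- g) (tnth x i) - mean (f \- g))|%:E |
     f in G & g in G].

(* Measurability of the suprema of the (weighted) empirical process over
   differences of elements of [G], as functions of the sample point in the
   product space S^n.  The weights e_i = 1/n give the supremum of
   |(P_n - P)(f - g)|; general weights (in particular 0/1 ones, i.e. subsamples)
   are those of the usual definition of a P-measurable class.  Measurability
   has to be required on S^n and not merely on Omega: the sigma-algebra of
   Omega may be larger than the one generated by the sample, and a supremum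
   that is measurable only with respect to the former need not inherit the
   independence of the X_i. *)
Definition measurable_suprema n G : Prop :=
  forall e : 'I_n -> R,
    measurable_fun [set: n.-tuple S] (sup_process G e).

Section ModelSelection.
Context (F : nat -> set (S -> R)).

Definition inf_mean_all : R := inf [set inf_mean (F k) | k in [set k | (1 <= k)%N]].

Definition kstar : option nat :=
  index_inf [set k | (1 <= k)%N /\
    forall l, (k < l)%N -> inf_mean (F k) = inf_mean (F l)].

(* [D l] is the maximum of the delta_bar's of the first l classes. *)
Definition kbar (c : R) (D : nat -> \bar R) : option nat :=
  index_inf [set k | (1 <= k)%N /\
    forall l, (k < l)%N -> ((inf_mean (F k) - inf_mean (F l))%:E <= c%:E * D l)%E].

Definition khat n (X : 'I_n -> {mfun Omega >-> S}) (c : R)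
    (D : nat -> Omega -> \bar R) (w : Omega) : option nat :=
  index_inf [set k | (1 <= k)%N /\
    forall l, (k < l)%N ->
      ((inf_emp_mean X (F k) w - inf_emp_mean X (F l) w)%:E <= c%:E * D l w)%E].

Definition oracle_bound (k0 : option nat) (C : R) (D : nat -> \bar R) : \bar R :=
  if k0 is Some k1 then
    ereal_inf [set ((inf_mean (F k) - inf_mean_all)%:E + C%:E * D k)%E |
               k in [set k | (k1 <= k)%N]]
  else 1%E.

End ModelSelection.

End RiskMinimization.

(* The selected minimizer; the first one when the selected index is infinite. *)
Definition selected (T Omega : Type) (fhat : nat -> Omega -> T)
    (k : Omega -> option nat) (w : Omega) : T :=
  fhat (odflt 1%N (k w)) w.

Definition failure_bound (R : realType) (q : R) (n : nat) (p t : nat -> R) : \bar R :=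
  (\sum_(1 <= k <oo)
     (p k + Num.max (ln (q ^+ 2 * n%:R / t k) / ln q) 0 * expR (- t k))%:E)%E.

(* Main.v *)
(** For each class and each level [q ^- j] above [dbar k], the supremum of the
    empirical process over the [q ^- j]-minimal set exceeds twice [Ubar] with
    probability at most [exp (- t k)], and at most [log_q (q^2 n / t k)] levels
    lie above [dbar k], because [Ubar >= 2 t / n].  Off these events the ratio of
    the empirical to the true excess risk is controlled on the whole class.  This
    gives [khat <= kbar], and bounds the excess risk of the selected function in
    every class of index [k >= kbar] by a multiple of [max_upto dtilde k].  The
    latter is bounded away from [0], which makes all inequalities strict and
    [kbar] finite.

    The deviation bound is a form of Talagrand's inequality with weaker constants
    than Bousquet's, proved by the entropy method: if [V] is the supremum and
    [V_i] the supremum without the [i]-th observation, then [V - V_i <= 1],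
    [\sum_i (V - V_i) <= V], and [V - V_i] dominates, up to any [e > 0], a centered
    function of the [i]-th observation with variance at most [s2 / 4].
    Tensorization of entropy turns this into
    [(l - l^2) L'(l) - L(l) <= l^2 n s2 / 8] for the log-Laplace transform [L] of
    [V]. *)

From HB Require Import structures.
Require Import Defs.
From mathcomp Require Import ring lra.

Set Implicit Arguments.
Unset Strict Implicit.
Unset Printing Implicit Defensive.
Import Order.TTheory GRing.Theory Num.Theory.
Import numFieldNormedType.Exports.

Local Open Scope classical_set_scope.
Local Open Scope ring_scope.

(** * Bounded measurable functions *)

Section BoundedMeasurable.
Context (R : realType) (d : measure_display) (T : measurableType d).
Implicit Types f g : T -> R.

(** The bound holds everywhere, not almost everywhere, so that the class is stable under sections,
    sums, products, exponentials and measurable changes of variable, and every mean in use is a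
    finite real. *)
Definition bounded_mfun f :=
  measurable_fun [set: T] f /\ exists M : R, forall x, `|f x| <= M.

Lemma bounded_mfun_cst (c : R) : bounded_mfun (fun=> c).
Proof. by split; [exact: measurable_cst | exists `|c|]. Qed.

Lemma bounded_mfunD f g :
  bounded_mfun f -> bounded_mfun g -> bounded_mfun (fun x => f x + g x).
Proof.
move=> [mf [M Mf]] [mg [N Ng]]; split; first exact: measurable_funD.
by exists (M + N) => x; rewrite (le_trans (ler_normD _ _))// lerD.
Qed.

Lemma bounded_mfunM f g :
  bounded_mfun f -> bounded_mfun g -> bounded_mfun (fun x => f x * g x).
Proof.
move=> [mf [M Mf]] [mg [N Ng]]; split; first exact: measurable_funM.
by exists (M * N) => x; rewrite normrM ler_pM.
Qed.

Lemma bounded_mfunN f : bounded_mfun f -> bounded_mfun (fun x => - f x).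
Proof.
move=> /(bounded_mfunM (bounded_mfun_cst (-1))).
by congr bounded_mfun; apply/funext => x; rewrite mulN1r.
Qed.

Lemma bounded_mfunB f g :
  bounded_mfun f -> bounded_mfun g -> bounded_mfun (fun x => f x - g x).
Proof. by move=> bf bg; apply: bounded_mfunD => //; exact: bounded_mfunN. Qed.

Lemma bounded_mfun_sum (I : Type) (r : seq I) (F : I -> T -> R) :
  (forall i, bounded_mfun (F i)) -> bounded_mfun (fun x => \sum_(i <- r) F i x).
Proof.
move=> bF; elim: r => [|i r IH].
  by under eq_fun do rewrite big_nil; exact: bounded_mfun_cst.
by under eq_fun do rewrite big_cons; exact: bounded_mfunD.
Qed.

Lemma bounded_mfun_expR f : bounded_mfun f -> bounded_mfun (fun x => expR (f x)).
Proof.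
move=> [mf [M Mf]]; split; first exact: measurableT_comp.
exists (expR M) => x; rewrite ger0_norm ?expR_ge0// ler_expR.
exact: le_trans (ler_norm _) (Mf x).
Qed.

Lemma bounded_mfun_ln (m : R) f : 0 < m -> (forall x, m <= f x) ->
  bounded_mfun f -> bounded_mfun (fun x => ln (f x)).
Proof.
move=> m0 mf [mef [M Mf]]; split; first exact: measurableT_comp.
exists (`|ln m| + `|ln M|) => x.
have fx0 : 0 < f x by exact: lt_le_trans (mf x).
have fM : f x <= M by exact: le_trans (ler_norm _) (Mf x).
have l1 : ln m <= ln (f x) by rewrite ler_ln ?posrE.
have l2 : ln (f x) <= ln M by rewrite ler_ln ?posrE// (lt_le_trans fx0).
have := ler_norm (ln M); have := ler_norm (- ln m); rewrite normrN.
by have := normr_ge0 (ln m); have := normr_ge0 (ln M); rewrite ler_norml; lra.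
Qed.

Variable P : probability T R.

Lemma bounded_mfun_integrable f :
  bounded_mfun f -> P.-integrable [set: T] (EFin \o f).
Proof.
move=> [mf [M Mf]]; apply: measurable_bounded_integrable => //.
  by move: (probability_le1 P measurableT) => /le_lt_trans; apply; rewrite ltry.
by exists M; split; [exact: num_real|] => x Mx y _ /=; rewrite (le_trans (Mf y))// ltW.
Qed.

Lemma mean_cst (c : R) : mean P (fun=> c) = c.
Proof.
rewrite /mean Rintegral_cst// [X in fine X](_ : _ = 1%E) ?mulr1//.
exact: probability_setT.
Qed.

Lemma meanD f g : bounded_mfun f -> bounded_mfun g ->
  mean P (fun x => f x + g x) = mean P f + mean P g.
Proof. by move=> bf bg; rewrite /mean RintegralD//; exact: bounded_mfun_integrable. Qed.

Lemma meanB f g : bounded_mfun f -> bounded_mfun g ->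
  mean P (fun x => f x - g x) = mean P f - mean P g.
Proof. by move=> bf bg; rewrite /mean RintegralB//; exact: bounded_mfun_integrable. Qed.

Lemma meanZl (c : R) f : bounded_mfun f ->
  mean P (fun x => c * f x) = c * mean P f.
Proof. by move=> bf; rewrite /mean RintegralZl//; exact: bounded_mfun_integrable. Qed.

Lemma meanZr (c : R) f : bounded_mfun f ->
  mean P (fun x => f x * c) = mean P f * c.
Proof. by move=> bf; rewrite /mean RintegralZr//; exact: bounded_mfun_integrable. Qed.

Lemma le_mean f g : bounded_mfun f -> bounded_mfun g ->
  (forall x, f x <= g x) -> mean P f <= mean P g.
Proof. by move=> bf bg fg; apply: le_Rintegral => //; exact: bounded_mfun_integrable. Qed.

Lemma mean_ge (c : R) f : bounded_mfun f -> (forall x, c <= f x) -> c <= mean P f.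
Proof.
by move=> bf cf; rewrite -[leLHS]mean_cst; apply: le_mean => //; exact: bounded_mfun_cst.
Qed.

Lemma mean_le (c : R) f : bounded_mfun f -> (forall x, f x <= c) -> mean P f <= c.
Proof.
by move=> bf cf; rewrite -[leRHS]mean_cst; apply: le_mean => //; exact: bounded_mfun_cst.
Qed.

Lemma mean_sum (I : Type) (r : seq I) (F : I -> T -> R) :
  (forall i, bounded_mfun (F i)) ->
  mean P (fun x => \sum_(i <- r) F i x) = \sum_(i <- r) mean P (F i).
Proof.
move=> bF; elim: r => [|i r IH].
  by under eq_fun do rewrite big_nil; rewrite mean_cst big_nil.
under eq_fun do rewrite big_cons; rewrite meanD ?IH ?big_cons//.
exact: bounded_mfun_sum.
Qed.

Lemma EFin_mean f : bounded_mfun f -> (mean P f)%:E = (\int[P]_x (f x)%:E)%E.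
Proof.
move=> bf; rewrite /mean /Rintegral fineK//.
by apply: integrable_fin_num => //; exact: bounded_mfun_integrable.
Qed.

End BoundedMeasurable.

Lemma bounded_mfun_comp (R : realType) d d' (T : measurableType d)
    (U : measurableType d') (h : U -> T) (f : T -> R) :
  measurable_fun [set: U] h -> bounded_mfun f -> bounded_mfun (f \o h).
Proof.
by move=> mh [mf [M Mf]]; split; [exact: measurableT_comp | exists M => x /=].
Qed.

(** * Iterated means over a product of two laws *)

Section ProductMean.
Context (R : realType) (d d' : measure_display) (T : measurableType d)
  (U : measurableType d') (P : probability T R) (Q : probability U R).
Variable f : T * U -> R.
Hypothesis bf : bounded_mfun f.

Lemma bounded_mfun_pair1 x : bounded_mfun (fun y => f (x, y)).
Proof. exact: bounded_mfun_comp bf. Qed.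

Lemma bounded_mfun_pair2 y : bounded_mfun (fun x => f (x, y)).
Proof. exact: bounded_mfun_comp bf. Qed.

Lemma bounded_mfun_mean2 : bounded_mfun (fun x => mean Q (fun y => f (x, y))).
Proof.
have [_ [M Mf]] := bf; split; last first.
  exists M => x; rewrite ler_norml; apply/andP; split.
    apply: mean_ge; first exact: bounded_mfun_pair1.
    by move=> y; have := Mf (x, y); rewrite ler_norml => /andP[].
  apply: mean_le; first exact: bounded_mfun_pair1.
  by move=> y; have := Mf (x, y); rewrite ler_norml => /andP[].
apply: (measurableT_comp (f := fine)) => //.
exact: (measurable_fubini_F (bounded_mfun_integrable (P \x Q)%E bf)).
Qed.

Lemma bounded_mfun_mean1 : bounded_mfun (fun y => mean P (fun x => f (x, y))).
Proof.
have [_ [M Mf]] := bf; split; last first.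
  exists M => x; rewrite ler_norml; apply/andP; split.
    apply: mean_ge; first exact: bounded_mfun_pair2.
    by move=> y; have := Mf (y, x); rewrite ler_norml => /andP[].
  apply: mean_le; first exact: bounded_mfun_pair2.
  by move=> y; have := Mf (y, x); rewrite ler_norml => /andP[].
apply: (measurableT_comp (f := fine)) => //.
exact: (measurable_fubini_G (bounded_mfun_integrable (P \x Q)%E bf)).
Qed.

Lemma mean_prod12 :
  mean (P \x Q)%E f = mean P (fun x => mean Q (fun y => f (x, y))).
Proof.
apply: EFin_inj; rewrite !EFin_mean//; last exact: bounded_mfun_mean2.
rewrite -integral12_prod_meas1; last exact: bounded_mfun_integrable.
apply: eq_integral => x _; rewrite EFin_mean//; exact: bounded_mfun_pair1.
Qed.

Lemma mean_prod21 :
  mean (P \x Q)%E f = mean Q (fun y => mean P (fun x => f (x, y))).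
Proof.
apply: EFin_inj; rewrite !EFin_mean//; last exact: bounded_mfun_mean1.
rewrite -integral21_prod_meas1; last exact: bounded_mfun_integrable.
apply: eq_integral => x _; rewrite EFin_mean//; exact: bounded_mfun_pair2.
Qed.

End ProductMean.

(** * Entropy *)

Ltac bounded_mfun_tac := solve [repeat first
  [ assumption | exact: bounded_mfun_cst | apply: bounded_mfunB
  | apply: bounded_mfunD | apply: bounded_mfunN | apply: bounded_mfunM
  | apply: bounded_mfun_expR
  | apply: bounded_mfun_pair1 | apply: bounded_mfun_pair2 ]].

(** This is 1 + x <= exp x at x = ln (b / a), multiplied by a. Both variational formulas for the
    entropy come from it. *)
Lemma subr_le_mul_lnB (R : realType) (a b : R) : 0 < a -> 0 < b ->
  a - b <= a * (ln a - ln b).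
Proof.
move=> a0 b0; have := expR_ge1Dx (ln (b / a)).
rewrite lnK ?posrE ?divr_gt0// ln_div ?posrE// => h.
have : a * (1 + (ln b - ln a)) <= a * (b / a) by rewrite ler_pM2l.
rewrite [a * (b / a)]mulrC divfK ?gt_eqF//; lra.
Qed.

Section Entropy.
Context (R : realType) (d : measure_display) (T : measurableType d)
  (P : probability T R).
Implicit Types g : T -> R.

Definition entropy g : R :=
  mean P (fun x => g x * ln (g x)) - mean P g * ln (mean P g).

(** With M = [mean P g], the right side exceeds the left by M (ln M - ln c) - (M - c) >= 0, which
    vanishes at c = M. The free choice of c permits comparison with a value that ignores one
    coordinate. *)
Lemma entropy_le (m c : R) g : 0 < m -> (forall x, m <= g x) -> bounded_mfun g ->
  0 < c ->
  entropy g <= mean P (fun x => g x * (ln (g x) - ln c) - g x + c).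
Proof.
move=> m0 mg bg c0.
have bl : bounded_mfun (fun x => ln (g x)) by exact: bounded_mfun_ln m0 mg bg.
have gt0 : 0 < mean P g by apply: lt_le_trans m0 _; exact: mean_ge.
have := subr_le_mul_lnB gt0 c0.
rewrite meanD ?meanB; try bounded_mfun_tac.
under [X in mean P X - _ + _ ]eq_fun do rewrite mulrBr.
rewrite meanB ?meanZr ?mean_cst; try bounded_mfun_tac.
by rewrite /entropy; lra.
Qed.

(** Gibbs variational principle: [subr_le_mul_lnB] is integrated with a = g x and b =
    [mean P g * expR (v x)], and a - b has mean 0 by the normalization of v. *)
Lemma entropy_ge_mean (m : R) g v : 0 < m -> (forall x, m <= g x) ->
  bounded_mfun g -> bounded_mfun v -> mean P (fun x => expR (v x)) = 1 ->
  mean P (fun x => g x * v x) <= entropy g.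
Proof.
move=> m0 mg bg bv ev.
have bl : bounded_mfun (fun x => ln (g x)) by exact: bounded_mfun_ln m0 mg bg.
have gt0 : 0 < mean P g by apply: lt_le_trans m0 _; exact: mean_ge.
rewrite /entropy -subr_ge0 -meanZr// -!meanB; try bounded_mfun_tac.
have <- : mean P (fun x => g x - mean P g * expR (v x)) = 0.
  by rewrite meanB ?meanZl ?ev ?mulr1 ?subrr//; try bounded_mfun_tac.
apply: le_mean; try bounded_mfun_tac.
move=> x; have gx0 : 0 < g x by exact: lt_le_trans (mg x).
have := subr_le_mul_lnB gx0 (mulr_gt0 gt0 (expR_gt0 (v x))).
by rewrite lnM ?posrE ?expR_gt0// expRK; lra.
Qed.

End Entropy.

(** * Subadditivity of entropy on a product of two spaces *)

Section EntropyProduct.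
Context (R : realType) (d d' : measure_display) (T : measurableType d)
  (U : measurableType d') (P : probability T R) (Q : probability U R).
Variables (g : T * U -> R) (m : R).
Hypotheses (m0 : 0 < m) (mg : forall z, m <= g z) (bg : bounded_mfun g).

Let bl : bounded_mfun (fun z => ln (g z)).
Proof. exact: bounded_mfun_ln m0 mg bg. Qed.

Let bgl : bounded_mfun (fun z => g z * ln (g z)).
Proof. bounded_mfun_tac. Qed.

Let m_mean1 y : m <= mean P (fun x => g (x, y)).
Proof. by apply: mean_ge => //; bounded_mfun_tac. Qed.

Let m_mean2 x : m <= mean Q (fun y => g (x, y)).
Proof. by apply: mean_ge => //; bounded_mfun_tac. Qed.

Lemma bounded_mfun_entropy2 :
  bounded_mfun (fun x => entropy Q (fun y => g (x, y))).
Proof.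
have b1 := bounded_mfun_mean2 P Q bgl.
have b2 := bounded_mfun_mean2 P Q bg.
have b3 := bounded_mfun_ln m0 m_mean2 b2.
by rewrite /entropy; bounded_mfun_tac.
Qed.

Lemma bounded_mfun_entropy1 :
  bounded_mfun (fun y => entropy P (fun x => g (x, y))).
Proof.
have b1 := bounded_mfun_mean1 P Q bgl.
have b2 := bounded_mfun_mean1 P Q bg.
have b3 := bounded_mfun_ln m0 m_mean1 b2.
by rewrite /entropy; bounded_mfun_tac.
Qed.

(* Convexity of entropy: the variational formula [entropy_ge_mean], with [v] optimal
   for the averaged function, is integrated over [x]. *)
Lemma entropy_mean_le :
  entropy Q (fun y => mean P (fun x => g (x, y))) <=
  mean P (fun x => entropy Q (fun y => g (x, y))).
Proof.
pose h y := mean P (fun x => g (x, y)); pose M := mean Q h.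
have bh : bounded_mfun h by exact: bounded_mfun_mean1.
have blh : bounded_mfun (fun y => ln (h y)) by exact: bounded_mfun_ln m0 m_mean1 bh.
have M0 : 0 < M by apply: lt_le_trans m0 _; exact: mean_ge.
have h0 y : 0 < h y by exact: lt_le_trans (m_mean1 y).
pose v y := ln (h y) - ln M.
have bv : bounded_mfun v by bounded_mfun_tac.
have ev : mean Q (fun y => expR (v y)) = 1.
  rewrite /v (_ : (fun y => _) = (fun y => h y * M^-1)).
    by rewrite meanZr// divff ?gt_eqF.
  by apply/funext => y; rewrite expRD expRN !lnK ?posrE.
have bv2 : bounded_mfun (fun z : T * U => v z.2) by exact: bounded_mfun_comp bv.
have bgv : bounded_mfun (fun z : T * U => g z * v z.2) by bounded_mfun_tac.
suff -> : entropy Q h = mean P (fun x => mean Q (fun y => g (x, y) * v y)).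
  apply: le_mean.
  - exact: (bounded_mfun_mean2 P Q bgv).
  - exact: bounded_mfun_entropy2.
  - by move=> x; apply: entropy_ge_mean m0 _ _ _ _ => //; bounded_mfun_tac.
rewrite -(mean_prod12 P Q bgv) (mean_prod21 P Q bgv)/=.
rewrite /entropy -/M -meanZr// -meanB; try bounded_mfun_tac.
congr mean; apply/funext => y.
by rewrite meanZr; [rewrite -/(h y) /v mulrBr | bounded_mfun_tac].
Qed.

(** Chain rule: the joint entropy is the mean over y of the entropies in x plus the entropy of the
    marginal in y, and convexity bounds the latter. *)
Lemma entropy_prod_le :
  entropy (P \x Q)%E g <= mean Q (fun y => entropy P (fun x => g (x, y))) +
                          mean P (fun x => entropy Q (fun y => g (x, y))).
Proof.
apply: le_trans (lerD (lexx _) entropy_mean_le).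
rewrite {1 2}/entropy meanB.
- by rewrite -(mean_prod21 P Q bgl) (mean_prod21 P Q bg) /entropy; lra.
- exact: (bounded_mfun_mean1 P Q bgl).
- apply: bounded_mfunM; first exact: (bounded_mfun_mean1 P Q bg).
  by apply: (bounded_mfun_ln m0 m_mean1); exact: (bounded_mfun_mean1 P Q bg).
Qed.

End EntropyProduct.

(** * Law of an i.i.d. sample *)

Lemma mean_distribution (R : realType) d d' (T : measurableType d)
    (U : measurableType d') (P : probability T R) (X : {mfun T >-> U}) (f : U -> R) :
  bounded_mfun f -> mean (distribution P X) f = mean P (f \o X).
Proof.
move=> bf; apply: EFin_inj; rewrite !EFin_mean//; last exact: bounded_mfun_comp bf.
rewrite integral_distribution//; first by apply/measurable_EFinP; case: bf.
by apply: (bounded_mfun_integrable P); exact: bounded_mfun_comp bf.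
Qed.

Lemma mean_dirac (R : realType) d (T : measurableType d) (a : T) (f : T -> R) :
  measurable_fun [set: T] f -> mean (dirac a) f = f a.
Proof.
move=> mf; rewrite /mean /Rintegral integral_dirac ?diracT ?mul1e//.
exact/measurable_EFinP.
Qed.

Lemma probability_nonempty (R : realType) d (T : measurableType d)
  (P : probability T R) : [set: T] !=set0.
Proof.
apply/set0P/eqP => T0; have := probability_setT P.
by rewrite T0 measure0 => /eqP; rewrite eq_sym onee_eq0.
Qed.

Section TupleLaw.
Context (R : realType) (d : measure_display) (S : measurableType d)
  (P : probability S R).

Definition tuple_cons n (z : S * n.-tuple S) : n.+1.-tuple S :=
  [tuple of z.1 :: z.2].

Lemma measurable_tuple_cons n : measurable_fun [set: S * n.-tuple S] (@tuple_cons n).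
Proof. exact: measurable_cons. Qed.

HB.instance Definition _ n :=
  isMeasurableFun.Build _ _ _ _ (@tuple_cons n) (@measurable_tuple_cons n).

(** The n-fold product law, built by prepending one independent coordinate at a time so that
    tensorization is an induction on n. *)
Fixpoint tuple_law n : probability (n.-tuple S) R :=
  if n is n'.+1 then
    distribution (P \x tuple_law n')%E (@tuple_cons n')
  else dirac [tuple].


Definition box n (A : 'I_n -> set S) : set (n.-tuple S) :=
  \bigcap_(i in [set: 'I_n]) [set x | A i (tnth x i)].

Lemma measurable_box n (A : 'I_n -> set S) :
  (forall i, measurable (A i)) -> measurable (box A).
Proof.
move=> mA; apply: fin_bigcap_measurable; first exact: finite_finset.
move=> i _; rewrite -[X in measurable X]setTI.
exact: (@measurable_tnth _ S n i measurableT (A i) (mA i)).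
Qed.

Lemma tuple_law_box n (A : 'I_n -> set S) : (forall i, measurable (A i)) ->
  tuple_law n (box A) = (\prod_(i < n) P (A i))%E.
Proof.
elim: n A => [|n IH] A mA /=.
  by rewrite big_ord0 diracE mem_set//; move=> [].
rewrite /distribution /pushforward/= big_ord_recl -IH//.
rewrite -product_measure1E//; last exact: measurable_box.
congr (_ _); apply/seteqP; split => -[x r] /=.
- move=> Axr; split; first exact: (Axr ord0).
  by move=> i _ /=; have := Axr (lift ord0 i) I; rewrite /tuple_cons /= tnthS.
- move=> [Ax Ar] i _ /=; have [->//|i0] := eqVneq i ord0.
  have [j ->] : exists j, i = lift ord0 j.
    by case: (unliftP ord0 i) i0 => [j ->|->]; [exists j|rewrite eqxx].
  by rewrite /tuple_cons tnthS; exact: (Ar j).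
Qed.

Lemma measurable_box_generated n :
  @measurable _ (n.-tuple S) =
  <<s [set B | exists2 A : 'I_n -> set S, forall i, measurable (A i) & B = box A] >>.
Proof.
apply/seteqP; split.
  apply: smallest_sub; first exact: smallest_sigma_algebra.
  move=> B; rewrite -bigcup_seq => -[i _ [A mA <-]].
  apply: sub_sigma_algebra; exists (fun j => if j == i then A else setT).
    by move=> j; case: ifP.
  apply/seteqP; split => [x [_ Ax] j _ /=|x Ax].
    by case: ifP => [/eqP ->|].
  by split => //; have := Ax i I; rewrite /= eqxx.
apply: smallest_sub; first exact: sigma_algebra_measurable.
by move=> _ [A mA ->]; exact: measurable_box.
Qed.

Section Sample.
Context (d' : measure_display) (Omega : measurableType d') (Pr : probability Omega R).
Context (n : nat) (X : 'I_n -> {mfun Omega >-> S}).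

Definition sample (w : Omega) : n.-tuple S := [tuple X i w | i < n].

Lemma measurable_sample : measurable_fun [set: Omega] sample.
Proof.
apply/measurable_fun_tnthP => i.
rewrite (_ : _ \o _ = X i); first exact: measurable_funP.
by apply/funext => w /=; rewrite tnth_mktuple.
Qed.

HB.instance Definition _ :=
  isMeasurableFun.Build _ _ _ _ sample measurable_sample.

(** Boxes form a pi-system generating the product sigma-algebra, and independence over all indices
    at once makes the two laws agree on them. *)
Lemma distribution_sample (A : set (n.-tuple S)) : iid_sample P Pr X ->
  measurable A -> distribution Pr sample A = tuple_law n A.
Proof.
move=> [XP XI] mA.
pose G := [set B | exists2 A : 'I_n -> set S, forall i, measurable (A i) & B = box A].
apply: (measure_unique G (fun=> setT)) => //.
- exact: measurable_box_generated.
- move=> _ _ [A1 mA1 ->] [A2 mA2 ->]; exists (fun i => A1 i `&` A2 i).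
    by move=> i; exact: measurableI.
  apply/seteqP; split=> [x [h1 h2] i _|x h].
    by split; [exact: h1|exact: h2].
  by split=> i _; have [] := h i I.
- move=> _; exists (fun=> setT) => //.
  by apply/seteqP; split.
- by rewrite bigcup_const.
- move=> _ [B mB ->]; apply: etrans (esym (tuple_law_box mB)).
  transitivity (\prod_(i in [set: 'I_n]%SET) Pr (X i @^-1` B i))%E; last first.
    rewrite (eq_bigl predT); last by move=> i; rewrite inE.
    by apply: eq_bigr => i _; exact: XP.
  rewrite -XI//; congr (Pr _); apply/seteqP; split=> w h i _ /=.
    by have := h i I; rewrite /= tnth_mktuple.
  by rewrite tnth_mktuple; apply: h; rewrite /= inE.
- by move=> _; exact: le_lt_trans (probability_le1 _ _) (ltry _).
Qed.

Lemma mean_sample (f : n.-tuple S -> R) : iid_sample P Pr X -> bounded_mfun f ->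
  mean Pr (f \o sample) = mean (tuple_law n) f.
Proof.
move=> iX bf; rewrite -mean_distribution// /mean /Rintegral.
by congr fine; apply: eq_measure_integral => A mA _; exact: distribution_sample.
Qed.

End Sample.

Definition tuple_set n (x : n.-tuple S) (i : 'I_n) (y : S) : n.-tuple S :=
  [tuple if j == i then y else tnth x j | j < n].

Lemma tuple_set0 n (x y : S) (r : n.-tuple S) :
  tuple_set (tuple_cons (x, r)) ord0 y = tuple_cons (y, r).
Proof.
apply: eq_from_tnth => i; rewrite tnth_mktuple.
by case: (unliftP ord0 i) => [j ->|->]; rewrite /tuple_cons /= ?tnthS ?tnth0.
Qed.

Lemma tuple_setS n (x y : S) (r : n.-tuple S) i :
  tuple_set (tuple_cons (x, r)) (lift ord0 i) y = tuple_cons (x, tuple_set r i y).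
Proof.
apply: eq_from_tnth => k; rewrite tnth_mktuple.
case: (unliftP ord0 k) => [j ->|->]; rewrite /tuple_cons /= ?tnthS ?tnth0//.
by rewrite tnth_mktuple (inj_eq (@lift_inj _ ord0)).
Qed.

Lemma measurable_tuple_set n (x : n.-tuple S) i : measurable_fun [set: S] (tuple_set x i).
Proof.
apply/measurable_fun_tnthP => j.
rewrite (_ : _ \o _ = fun y => if j == i then y else tnth x j).
  by case: (j == i); [exact: measurable_id|exact: measurable_cst].
by apply/funext => y /=; rewrite tnth_mktuple.
Qed.

(** Tensorization of entropy, by splitting off the first coordinate. [B i] has to dominate the
    entropy in the i-th coordinate only after averaging over that coordinate, which is the form in
    which one-coordinate bounds are available. *)
Lemma entropy_tuple_law_le n (g : n.-tuple S -> R) (m : R)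
    (B : 'I_n -> n.-tuple S -> R) :
  0 < m -> (forall x, m <= g x) -> bounded_mfun g ->
  (forall i, bounded_mfun (B i)) ->
  (forall i x, entropy P (fun y => g (tuple_set x i y)) <=
               mean P (fun y => B i (tuple_set x i y))) ->
  entropy (tuple_law n) g <= \sum_(i < n) mean (tuple_law n) (B i).
Proof.
move=> m0; elim: n g B => [|n IH] g B mg bg bB gB.
  have blg := bounded_mfun_ln m0 mg bg.
  rewrite big_ord0 /entropy !mean_dirac ?subrr//; first by case: bg.
  by have [] := bounded_mfunM bg blg.
have bgc : bounded_mfun (g \o @tuple_cons n).
  by apply: bounded_mfun_comp bg; exact: measurable_tuple_cons.
have bBc i : bounded_mfun (B i \o @tuple_cons n).
  by apply: bounded_mfun_comp (bB i); exact: measurable_tuple_cons.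
have -> : entropy (tuple_law n.+1) g = entropy (P \x tuple_law n)%E (g \o @tuple_cons n).
  rewrite /entropy /= !mean_distribution//.
  have blg := bounded_mfun_ln m0 mg bg; bounded_mfun_tac.
have mgc z : m <= (g \o @tuple_cons n) z by exact: mg.
apply: (le_trans (entropy_prod_le P (tuple_law n) m0 mgc bgc)).
rewrite big_ord_recl; apply: lerD.
  rewrite [leRHS]mean_distribution// [leRHS]mean_prod21//.
  apply: le_mean; first exact: (bounded_mfun_entropy1 P (tuple_law n) m0).
    exact: (bounded_mfun_mean1 P (tuple_law n) (bBc ord0)).
  (* Any [x0] serves, since [tuple_set] overwrites the first coordinate. *)
  move=> r; have [x0 _] := probability_nonempty P.
  have := gB ord0 (tuple_cons (x0, r)).
  under eq_fun do rewrite tuple_set0.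
  by under [X in _ <= mean _ X -> _]eq_fun do rewrite tuple_set0.
rewrite (eq_bigr (fun i => mean P (fun x => mean (tuple_law n) (fun r =>
  B (lift ord0 i) (tuple_cons (x, r)))))); last first.
  by move=> i _; rewrite [LHS]mean_distribution// [LHS]mean_prod12.
rewrite -mean_sum; last first.
  by move=> i; exact: (bounded_mfun_mean2 P (tuple_law n) (bBc (lift ord0 i))).
apply: le_mean; first exact: (bounded_mfun_entropy2 P (tuple_law n) m0).
  apply: bounded_mfun_sum => i.
  exact: (bounded_mfun_mean2 P (tuple_law n) (bBc (lift ord0 i))).
move=> x; apply: (IH (fun r => g (tuple_cons (x, r)))
  (fun i r => B (lift ord0 i) (tuple_cons (x, r)))) => //.
- exact: (bounded_mfun_pair1 bgc).
- by move=> i; exact: (bounded_mfun_pair1 (bBc (lift ord0 i))).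
- move=> i r; have := gB (lift ord0 i) (tuple_cons (x, r)).
  under eq_fun do rewrite tuple_setS.
  by under [X in _ <= mean _ X -> _]eq_fun do rewrite tuple_setS.
Qed.

End TupleLaw.

(** * Exponential inequalities and the Laplace transform *)

Section RealInequalities.
Context (R : realType).
Implicit Types (f df : R -> R) (x y d l : R).

Lemma is_derive_ge0_le f df a b : a <= b ->
  (forall x, a <= x <= b -> is_derive x 1 f (df x)) ->
  (forall x, a <= x <= b -> 0 <= df x) -> f a <= f b.
Proof.
move=> ab fdf df0.
have iab x : x \in `]a, b[ -> a <= x <= b.
  by rewrite in_itv/= => /andP[/ltW -> /ltW ->].
apply: (@ger0_derive1_le_cc _ f a b) => //.
- by move=> x /iab /fdf [].
- by move=> x /iab xab; rewrite derive1E; have [_ ->] := fdf _ xab; exact: df0.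
- apply: derivable_within_continuous => x; rewrite in_itv/= => /fdf [] //.
- by rewrite in_itv/= lexx ab.
- by rewrite in_itv/= lexx ab.
Qed.

Lemma expR_ge_quadratic x : 0 <= x -> 1 + x + x ^+ 2 / 2 <= expR x.
Proof.
move=> x0; pose f (y : R) := expR y - y - y * y / 2.
have : f 0 <= f x.
  apply: (@is_derive_ge0_le f (fun y => expR y - 1 - y)) => // y _.
    apply: is_derive_eq; rewrite /GRing.scale/=; lra.
  by have := expR_ge1Dx y; lra.
by rewrite /f expR0 expr2; lra.
Qed.

(* With [x = l * (V - V_i)], [expR (l * V_i) * (x * expR x - expR x + 1)] is the
   integrand that [entropy_le] gives for [expR (l * V)]. *)
Lemma entropy_fun_le_nonpos x : x <= 0 ->
  x * expR x - expR x + 1 <= x ^+ 2 / 2.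
Proof.
move=> x0; pose f (y : R) := y * expR y - expR y - y * y / 2.
have : f x <= f 0.
  apply: (@is_derive_ge0_le f (fun y => y * (expR y - 1))) => // y.
    by move=> _; apply: is_derive_eq; rewrite /GRing.scale/=; lra.
  by move=> /andP[_ y0]; rewrite mulr_le0// subr_le0 expR_le1.
by rewrite /f expR0 expr2; lra.
Qed.

Lemma entropy_fun_le_nonneg x : 0 <= x ->
  x * expR x - expR x + 1 <= x ^+ 2 / 2 + x ^+ 2 * (expR x - 1).
Proof.
move=> x0; have := expR_ge_quadratic x0.
(* The claim rearranges to 1 + x^2 / 2 <= (x^2 - x + 1) exp x; inserting the quadratic lower bound
   for exp x leaves x^3 / 2 + x^4 / 2 to spare. *)
have p : 0 < x ^+ 2 - x + 1 by nra.
rewrite -(ler_pM2l p) => h.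
have : 0 <= x ^+ 3 by rewrite exprn_ge0.
have : 0 <= x ^+ 4 by rewrite exprn_ge0.
by nra.
Qed.

(* The right-hand side is nonincreasing in [y <= 1], so [y = d] is the worst case. *)
Lemma entropy_fun_le l d y : 0 < l -> y <= d -> d <= 1 ->
  (l * d) * expR (l * d) - expR (l * d) + 1 <=
  l ^+ 2 / 2 * (y ^+ 2) - l ^+ 2 * y + l ^+ 2 * (d * expR (l * d)).
Proof.
move=> l0 yd d1.
have h : (l * d) * expR (l * d) - expR (l * d) + 1 <=
    (l * d) ^+ 2 / 2 + l ^+ 2 * (d * (expR (l * d) - 1)).
  have l20 : 0 <= l ^+ 2 by rewrite sqr_ge0.
  have [d0|d0] := leP d 0.
    apply: le_trans (entropy_fun_le_nonpos _) _; first by rewrite pmulr_rle0.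
    rewrite lerDl mulr_ge0// mulr_le0// subr_le0 expR_le1 pmulr_rle0//.
  apply: le_trans (entropy_fun_le_nonneg _) _; first by rewrite mulr_ge0// ltW.
  rewrite lerD2l exprMn -mulrA ler_wpM2l// ler_wpM2r//; last first.
    by rewrite expr2 ger_pMr.
  by rewrite subr_ge0 -[leLHS]expR0 ler_expR mulr_ge0// ltW.
apply: le_trans h _.
have : 0 <= l ^+ 2 * ((d - y) * (1 - (y + d) / 2)).
  by rewrite mulr_ge0 ?sqr_ge0// mulr_ge0 ?subr_ge0//; lra.
rewrite exprMn; lra.
Qed.

(* [(1 - x) / x * ln (F x) - x * v / 2] is nonincreasing, and its limit at [0]
   is at most [a]. *)
Lemma log_laplace_le (F F' : R -> R) (v a c l : R) :
  0 < l < 1 -> 0 <= v -> 0 <= a -> 0 <= c ->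
  (forall x, 0 < x <= l -> is_derive x 1 F (F' x)) ->
  (forall x, 0 < x <= l -> 0 < F x) ->
  (forall x, 0 < x <= l ->
     x * F' x - F x * ln (F x) <= x ^+ 2 / 2 * v * F x + x ^+ 2 * F' x) ->
  (forall x, 0 < x <= l -> ln (F x) <= x * a + c * x ^+ 2) ->
  ln (F l) <= l / (1 - l) * (a + l * v / 2).
Proof.
move=> /andP[l0 l1] v0 a0 c0 dF F0 hF hF0.
pose K (x : R) := x * v / 2 - (x^-1 - 1) * ln (F x).
pose K' (x : R) := v / 2 + x ^- 2 * ln (F x) - (x^-1 - 1) * (F' x / F x).
have dK x : 0 < x <= l -> is_derive x 1 K (K' x).
  move=> xl; have x0 : x != 0 by case/andP: xl => /gt_eqF ->.
  have [dFx Fx0] := (dF _ xl, F0 _ xl).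
  have dl := is_derive1_comp (is_derive1_ln Fx0) dFx.
  have di := is_deriveV x0 (is_derive_id x 1).
  rewrite /K; apply: is_derive_eq.
  rewrite /K' /GRing.scale/=; ring.
have K_mono m : 0 < m <= l -> K m <= K l.
  move=> /andP[m0 ml]; apply: (is_derive_ge0_le (df := K') ml) => x.
    by move=> /andP[mx xl]; apply: dK; rewrite xl (lt_le_trans m0 mx).
  move=> /andP[mx xl]; have x0 := lt_le_trans m0 mx.
  have xl' : 0 < x <= l by rewrite x0.
  (* Dividing the differential inequality by x^2 F(x) gives exactly [K' x >= 0]. *)
  have Fx0 := F0 _ xl'; have := hF _ xl'.
  have p : 0 < (x ^+ 2 * F x)^-1 by rewrite invr_gt0 mulr_gt0// exprn_gt0.
  rewrite -(ler_pM2r p) -subr_ge0; congr (_ <= _).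
  by rewrite /K'; field; rewrite !gt_eqF.
have Kl m : 0 < m <= l -> - K l <= a + c * m.
  move=> ml; apply: le_trans (_ : - K m <= _); first by rewrite lerN2 K_mono.
  have [/andP[m0 ml'] h] := (ml, hF0 _ ml).
  have m1 : m < 1 by exact: le_lt_trans ml' l1.
  rewrite /K opprB lerBlDr.
  have p : 0 <= m^-1 - 1 by rewrite subr_ge0 -[leLHS]invr1 lef_pV2 ?posrE ?ltW.
  apply: le_trans (ler_wpM2l p h) _.
  have -> : (m^-1 - 1) * (m * a + c * m ^+ 2) = (1 - m) * (a + c * m).
    by field; rewrite gt_eqF.
  have := mulr_ge0 (ltW m0) a0; have := mulr_ge0 (ltW m0) v0.
  by have := mulr_ge0 (ltW m0) (mulr_ge0 c0 (ltW m0)); lra.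
have {Kl}: - K l <= a.
  (* [m] is chosen with (c + 1) m <= e; adding 1 keeps the divisor positive when c = 0. *)
  apply/ler_addgt0Pr => e e0; pose m := Num.min l (e / (c + 1)).
  have c1 : 0 < c + 1 by rewrite ltr_wpDl.
  have m0 : 0 < m by rewrite lt_min l0 divr_gt0.
  apply: le_trans (Kl m _) _; first by rewrite m0 ge_min lexx.
  rewrite lerD2l; apply: le_trans (_ : (c + 1) * m <= _).
    by rewrite mulrDl mul1r lerDl ltW.
  by rewrite mulrC -ler_pdivlMr// ge_min lexx orbT.
rewrite /K => h.
have p : 0 < l / (1 - l) by rewrite divr_gt0// subr_gt0.
have : (l^-1 - 1) * ln (F l) <= a + l * v / 2 by lra.
rewrite -(ler_pM2l p); congr (_ <= _).
by field; rewrite subr_eq0 !gt_eqF.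
Qed.

End RealInequalities.

(** * Derivative of the Laplace transform and its behaviour at 0 *)

Section Laplace.
Context (R : realType) (d : measure_display) (T : measurableType d)
  (P : probability T R) (V : T -> R).
Hypothesis bV : bounded_mfun V.

Lemma is_derive_laplace (a : R) :
  is_derive a 1 (fun x => mean P (fun y => expR (x * V y)))
    (mean P (fun y => V y * expR (a * V y))).
Proof.
have [mV [M MV]] := bV.
have bxV x : bounded_mfun (fun y => expR (x * V y)) by bounded_mfun_tac.
have d1E (x : R) y : is_derive x 1 (fun x : R => expR (x * V y)) (V y * expR (x * V y)).
  apply: is_derive_eq; rewrite /GRing.scale/=; ring.
(* A constant dominating the derivative in x of the integrand for all x in ]a - 1, a + 1[. *)
pose c := `|M| * expR ((`|a| + 1) * `|M|).
have Ia : `]a - 1, a + 1[%classic a by rewrite /= in_itv/=; lra.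
have iV x : `]a - 1, a + 1[%classic x ->
    P.-integrable setT (EFin \o (fun y => expR (x * V y))).
  by move=> _; exact: bounded_mfun_integrable.
have dV (x : R) y : `]a - 1, a + 1[%classic x -> setT y ->
   derivable (fun x : R => expR (x * V y)) x 1 by move=> _ _; case: (d1E x y).
have c0 (y : T) : 0 <= c by rewrite mulr_ge0 ?expR_ge0.
have ic : P.-integrable setT (EFin \o fun=> c).
  by apply: bounded_mfun_integrable; exact: bounded_mfun_cst.
have cub (x : R) y : `]a - 1, a + 1[%classic x -> setT y ->
    `|partial1of2 (fun (x : R) y => expR (x * V y)) x y| <= c.
  rewrite /= in_itv/= => /andP[ax xa] _; rewrite partial1of2E.
  have [_ ->] := d1E x y; rewrite normrM (ger0_norm (expR_ge0 _)).
  have VM : `|V y| <= `|M| by exact: le_trans (MV y) (ler_norm _).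
  rewrite ler_pM// ?expR_ge0// ler_expR.
  apply: le_trans (ler_norm _) _; rewrite normrM ler_pM//.
  have -> : x = a + (x - a) by rewrite addrC subrK.
  rewrite (le_trans (ler_normD _ _))// lerD2l ler_norml.
  by rewrite lerBrDl (ltW ax) lerBlDl ltW.
have := derivable_under_integral measurableT Ia iV dV c0 ic cub.
have := differentiation_under_integral measurableT Ia iV dV c0 ic cub.
rewrite derive1E => E D; apply: DeriveDef => //.
rewrite [LHS]E; apply: eq_Rintegral => y _.
by rewrite partial1of2E; have [_ ->] := d1E a y.
Qed.

(** With z = x V, applying exp z <= 1 + z exp z twice leaves a remainder of order x^2, and ln m <= m
    - 1 passes to the logarithm. This is the control near 0 that [log_laplace_le] asks for. *)
Lemma ln_laplace_le (M x : R) : (forall y, 0 <= V y <= M) -> 0 < x <= 1 ->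
  ln (mean P (fun y => expR (x * V y))) <=
  x * mean P V + M ^+ 2 * expR M * x ^+ 2.
Proof.
move=> VM /andP[x0 x1].
have bxV : bounded_mfun (fun y => expR (x * V y)) by bounded_mfun_tac.
pose c := M ^+ 2 * expR M * x ^+ 2.
have h : mean P (fun y => expR (x * V y)) <= 1 + (x * mean P V + c).
  rewrite -meanZl// -[X in _ + (_ + X)](mean_cst P) -meanD; try bounded_mfun_tac.
  rewrite -[X in X + _](mean_cst P) -meanD; try bounded_mfun_tac.
  apply: le_mean; try bounded_mfun_tac.
  move=> y; have /andP[V0 VyM] := VM y.
  set z := x * V y; have z0 : 0 <= z by rewrite mulr_ge0// ltW.
  have h : expR z <= 1 + z * expR z.
    have := expR_ge1Dx (- z).
    have e1 : expR (- z) * expR z = 1 by rewrite -expRD addNr expR0.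
    by rewrite -(ler_pM2r (expR_gt0 z)) e1; lra.
  have h2 : z * (z * expR z) <= c.
    rewrite mulrA -expr2 /c /z exprMn [leRHS]mulrC -mulrA ler_wpM2l ?sqr_ge0//.
    rewrite ler_pM ?sqr_ge0 ?expR_ge0// ?ler_sqr ?nnegrE ?(le_trans V0)//.
    by rewrite ler_expR (le_trans _ VyM)// ler_piMl.
  have : z * expR z <= z + z * (z * expR z).
    by have := ler_wpM2l z0 h; rewrite mulrDr mulr1.
  by lra.
apply: le_trans (_ : mean P (fun y => expR (x * V y)) - 1 <= _); last by rewrite -/c; lra.
rewrite lerBrDl; set m := mean _ _.
have m0 : 0 < m.
  apply: lt_le_trans (_ : expR 0 <= _); first exact: expR_gt0.
  apply: mean_ge => // y; rewrite ler_expR mulr_ge0 ?(ltW x0)//.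
  by have /andP[] := VM y.
by have := expR_ge1Dx (ln m); rewrite lnK ?posrE.
Qed.

End Laplace.

(** * Entropy in one coordinate *)

Section OneCoordinate.
Context (R : realType) (d : measure_display) (S : measurableType d)
  (P : probability S R).
Variables (D : S -> R) (s2 l : R).
Hypotheses (bD : bounded_mfun D) (D1 : forall y, D y <= 1) (l0 : 0 < l).
Hypothesis DY : forall e : R, 0 < e -> exists Y : S -> R,
  [/\ bounded_mfun Y, mean P Y = 0, mean P (fun y => Y y ^+ 2) <= s2 &
      forall y, Y y - e <= D y].

Let beD : bounded_mfun (fun y => expR (l * D y)).
Proof. bounded_mfun_tac. Qed.

(** By 1 + x <= exp x it suffices that D has nonnegative mean, which holds because D dominates
    centered functions up to an arbitrarily small error. *)
Lemma mean_expR_ge1 : 1 <= mean P (fun y => expR (l * D y)).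
Proof.
apply/ler_addgt0Pr => e e0.
have [Y [bY Y0 _ YD]] := DY (divr_gt0 e0 l0).
have : mean P (fun y => 1 + l * (Y y - e / l)) <= mean P (fun y => expR (l * D y)).
  apply: le_mean; try bounded_mfun_tac.
  move=> y; apply: le_trans (expR_ge1Dx _).
  by rewrite lerD2l ler_wpM2l ?(ltW l0).
rewrite meanD ?meanZl ?meanB ?mean_cst ?Y0; try bounded_mfun_tac.
by rewrite sub0r mulrN mulrC divfK ?gt_eqF//; lra.
Qed.

(** [entropy_fun_le] is integrated with d = D y and y replaced by Y y - e. The term linear in Y has
    mean 0, the square contributes s2, and e tends to 0. *)
Lemma mean_entropy_fun_le :
  mean P (fun y => (l * D y) * expR (l * D y) - expR (l * D y) + 1) <=
  l ^+ 2 / 2 * s2 + l ^+ 2 * mean P (fun y => D y * expR (l * D y)).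
Proof.
apply/ler_addgt0Pr => e0 e00.
(* e <= 1 gives e^2 / 2 + e <= 2 e, and the second bound makes 2 l^2 e at most [e0]. *)
pose e := Num.min 1 (e0 / (2 * l ^+ 2)).
have l20 : 0 < l ^+ 2 by rewrite exprn_gt0.
have e_gt0 : 0 < e by rewrite lt_min ltr01 divr_gt0// mulr_gt0.
have e1 : e <= 1 by rewrite ge_min lexx.
have ee0 : 2 * l ^+ 2 * e <= e0.
  by rewrite mulrC -ler_pdivlMr ?mulr_gt0// ge_min lexx orbT.
have [Y [bY Y0 Ys YD]] := DY e_gt0.
have bY2 : bounded_mfun (fun y => Y y ^+ 2).
  by under eq_fun do rewrite expr2; bounded_mfun_tac.
apply: (@le_trans _ _ (mean P (fun y => l ^+ 2 / 2 * Y y ^+ 2 +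
    (l ^+ 2 * (D y * expR (l * D y)) + (- (l ^+ 2 * (e + 1)) * Y y +
     (l ^+ 2 * (e ^+ 2 / 2 + e))))))).
  apply: le_mean; try bounded_mfun_tac.
  by move=> y; apply: le_trans (entropy_fun_le l0 (YD y) (D1 y)) _; lra.
rewrite meanD; try bounded_mfun_tac.
rewrite meanD; try bounded_mfun_tac.
rewrite meanD; try bounded_mfun_tac.
rewrite !meanZl ?mean_cst ?Y0 ?mulr0; try bounded_mfun_tac.
rewrite add0r addrA lerD//.
  by rewrite lerD2r ler_wpM2l// divr_ge0// ltW.
apply: le_trans ee0; have -> : 2 * l ^+ 2 * e = l ^+ 2 * (2 * e) by ring.
rewrite ler_wpM2l ?(ltW l20)//.
by have := ler_piMl (ltW e_gt0) e1; lra.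
Qed.

End OneCoordinate.

(* [v] stands for the supremum without the resampled coordinate. *)
Lemma entropy_coordinate_le (R : realType) (d : measure_display)
    (S : measurableType d) (P : probability S R) (V : S -> R) (v s2 l : R) :
  bounded_mfun V -> (forall y, V y - v <= 1) -> 0 < l -> 0 <= s2 ->
  (forall e : R, 0 < e -> exists Y : S -> R,
    [/\ bounded_mfun Y, mean P Y = 0, mean P (fun y => Y y ^+ 2) <= s2 &
        forall y, Y y - e <= V y - v]) ->
  entropy P (fun y => expR (l * V y)) <=
  mean P (fun y => (l ^+ 2 / 2 * s2 + l ^+ 2 * (V y - v)) * expR (l * V y)).
Proof.
move=> bV V1 l0 s20 DY.
have bD : bounded_mfun (fun y => V y - v) by bounded_mfun_tac.
have beV : bounded_mfun (fun y => expR (l * V y)) by bounded_mfun_tac.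
have [_ [M MV]] := bV.
have eM y : expR (- (l * M)) <= expR (l * V y).
  rewrite ler_expR -mulrN ler_wpM2l ?(ltW l0)//.
  by have := MV y; rewrite ler_norml => /andP[].
(* The reference value c = exp (l v) turns the integrand into exp (l v) times a function of l (V -
   v) alone. *)
have := entropy_le P (expR_gt0 _) eM beV (expR_gt0 (l * v)).
move=> /le_trans; apply.
have eVE y : expR (l * V y) = expR (l * v) * expR (l * (V y - v)).
  by rewrite -expRD; congr expR; ring.
have h1 := mean_entropy_fun_le bD V1 l0 DY.
(* Used to multiply the constant l^2 s2 / 2 by the mean of exp (l (V - v)), so that the whole bound
   is weighted by exp (l V). *)
have h2 := mean_expR_ge1 bD l0 DY.
rewrite (_ : (fun x => _) = (fun y => expR (l * v) *
    ((l * (V y - v)) * expR (l * (V y - v)) - expR (l * (V y - v)) + 1))); last first.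
  by apply/funext => y; rewrite !expRK eVE; ring.
rewrite meanZl; last bounded_mfun_tac.
apply: le_trans (ler_wpM2l (expR_ge0 _) h1) _.
rewrite [X in _ <= mean P X](_ : _ = (fun y => expR (l * v) *
    (l ^+ 2 / 2 * s2 * expR (l * (V y - v)) +
     l ^+ 2 * ((V y - v) * expR (l * (V y - v)))))); last first.
  by apply/funext => y; rewrite eVE; ring.
rewrite meanZl; last bounded_mfun_tac.
rewrite meanD ?meanZl; try bounded_mfun_tac.
rewrite ler_wpM2l ?expR_ge0// lerD2r ler_peMr// mulr_ge0//.
by rewrite divr_ge0// sqr_ge0.
Qed.

(** * Concentration of suprema of empirical processes *)

Section SupProcess.
Context (R : realType) (d : measure_display) (S : measurableType d)
  (P : probability S R) (n : nat) (G : set (S -> R)).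
Hypothesis G0 : G !=set0.
Hypothesis G01 : forall f, G f -> measurable_fun [set: S] f /\ forall x, 0 <= f x <= 1.
Hypothesis mG : measurable_suprema P n G.
Implicit Types (f g : S -> R) (e : 'I_n -> R) (x : n.-tuple S).

Definition centered f g y := (f \- g) y - mean P (f \- g).

Definition process e f g x := \sum_(i < n) e i * centered f g (tnth x i).

Definition sup_real e x : R := fine (sup_process P G e x).

Lemma bounded_mfun_class f : G f -> bounded_mfun f.
Proof.
move=> /G01[mf f01]; split => //; exists 1 => x.
by have /andP[f0 f1] := f01 x; rewrite ger0_norm.
Qed.

Lemma bounded_mfun_classB f g : G f -> G g -> bounded_mfun (f \- g).
Proof. by move=> /bounded_mfun_class ? /bounded_mfun_class ?; exact: bounded_mfunB. Qed.

Lemma bounded_mfun_centered f g : G f -> G g -> bounded_mfun (centered f g).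
Proof.
move=> Gf Gg; have b := bounded_mfun_classB Gf Gg.
by rewrite /centered; bounded_mfun_tac.
Qed.

Lemma mean_centered f g : G f -> G g -> mean P (centered f g) = 0.
Proof.
move=> Gf Gg; have b := bounded_mfun_classB Gf Gg.
by rewrite /centered meanB ?mean_cst ?subrr//; exact: bounded_mfun_cst.
Qed.

Lemma centered_norm_le f g y : G f -> G g -> `|centered f g y| <= 2.
Proof.
move=> Gf Gg; have b := bounded_mfun_classB Gf Gg.
have h z : -1 <= (f \- g) z <= 1.
  have [[_ /(_ z)/andP[? ?]] [_ /(_ z)/andP[? ?]]] := (G01 Gf, G01 Gg).
  by rewrite /=; lra.
have : -1 <= mean P (f \- g) by apply: mean_ge => // z; case/andP: (h z).
have : mean P (f \- g) <= 1 by apply: mean_le => // z; case/andP: (h z).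
by have /andP[] := h y; rewrite /centered ler_norml; lra.
Qed.

Lemma centeredC f g y : G f -> G g -> centered g f y = - centered f g y.
Proof.
move=> Gf Gg; have [bf bg] := (bounded_mfun_class Gf, bounded_mfun_class Gg).
by rewrite /centered /= [mean P (f \- g)]meanB// [mean P (g \- f)]meanB//; ring.
Qed.

Lemma processC e f g x : G f -> G g -> process e g f x = - process e f g x.
Proof.
move=> Gf Gg; rewrite /process -sumrN; apply: eq_bigr => i _.
by rewrite centeredC// mulrN.
Qed.

Lemma process_norm_le e f g x : G f -> G g ->
  `|process e f g x| <= (\sum_(i < n) `|e i|) * 2.
Proof.
move=> Gf Gg; rewrite /process mulr_suml; apply: le_trans (ler_norm_sum _ _ _) _.
by apply: ler_sum => i _; rewrite normrM ler_wpM2l// centered_norm_le.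
Qed.

Lemma sup_processE e x : sup_process P G e x = (sup_real e x)%:E.
Proof.
rewrite /sup_real fineK//; have [f Gf] := G0; apply/fin_real; apply/andP; split.
  apply: lt_le_trans (ltNyr 0) _.
  apply: (@le_trans _ _ `|process e f f x|%:E); first by rewrite lee_fin.
  by apply: ereal_sup_ubound; exists f => //; exists f.
apply: le_lt_trans (ltry ((\sum_(i < n) `|e i|) * 2)).
by apply: ge_ereal_sup => _ [g Gg [h Gh <-]]; rewrite lee_fin process_norm_le.
Qed.

Lemma process_le_sup e f g x : G f -> G g -> process e f g x <= sup_real e x.
Proof.
move=> Gf Gg; rewrite -lee_fin -sup_processE.
apply: le_trans (_ : `|process e f g x|%:E <= _)%E; first by rewrite lee_fin ler_norm.
by apply: ereal_sup_ubound; exists f => //; exists g.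
Qed.

(** Exchanging f and g changes the sign of the process, so a one-sided bound over all pairs also
    bounds the absolute value. *)
Lemma sup_real_le e x (c : R) :
  (forall f g, G f -> G g -> process e f g x <= c) -> sup_real e x <= c.
Proof.
move=> h; rewrite -lee_fin -sup_processE.
apply: ge_ereal_sup => _ [g Gg [f Gf <-]].
rewrite lee_fin -/(process e g f x) ler_norml h// andbT.
by rewrite lerNl -processC// h.
Qed.

Lemma sup_real_adherent e x (c : R) : c < sup_real e x ->
  exists f g, [/\ G f, G g & c < process e f g x].
Proof.
move=> h; apply: contrapT => hN; move: h; apply/negP; rewrite -leNgt.
apply: sup_real_le => f g Gf Gg; rewrite leNgt; apply/negP => h.
by apply: hN; exists f, g.
Qed.

Lemma sup_real_ge0 e x : 0 <= sup_real e x.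
Proof.
have [f Gf] := G0; have := process_le_sup e x Gf Gf.
by have := processC e x Gf Gf; lra.
Qed.

Lemma sup_real_bounded e x : sup_real e x <= (\sum_(i < n) `|e i|) * 2.
Proof.
apply: sup_real_le => f g Gf Gg.
exact: le_trans (ler_norm _) (process_norm_le e x Gf Gg).
Qed.

Lemma bounded_mfun_sup_real e : bounded_mfun (sup_real e).
Proof.
split; last first.
  exists ((\sum_(i < n) `|e i|) * 2) => x.
  by rewrite ger0_norm ?sup_real_ge0// sup_real_bounded.
by apply: (measurableT_comp (f := fine)) => //; exact: mG.
Qed.

(* The factor [1/2] makes the summands bounded by [1]: centered differences of
   functions with values in [0, 1] are bounded by [2]. *)
Definition half_weight : 'I_n -> R := fun=> 2^-1.

(** An observation is left out by giving it weight 0 rather than by shortening the tuple, so all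
    suprema live on the same sample space. *)
Definition half_weight_but (i : 'I_n) : 'I_n -> R :=
  fun j => if j == i then 0 else 2^-1.

Let V := sup_real half_weight.
Let Vbut i := sup_real (half_weight_but i).

Lemma process_split i f g x :
  process half_weight f g x =
  process (half_weight_but i) f g x + 2^-1 * centered f g (tnth x i).
Proof.
rewrite /process (bigD1 i)//= addrC; congr (_ + _).
rewrite [RHS](bigD1 i)//= /half_weight_but eqxx mul0r add0r.
by apply: eq_bigr => j /negbTE ->.
Qed.

Lemma sup_half_le i x : V x <= Vbut i x + 1.
Proof.
apply: sup_real_le => f g Gf Gg; rewrite (process_split i).
apply: lerD; first exact: process_le_sup.
have := centered_norm_le (tnth x i) Gf Gg; rewrite ler_norml; lra.
Qed.

(** For a fixed pair f, g the n leave-one-out processes add up to n - 1 times the full one, whence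
    (n - 1) V <= \sum_i V_i. The proof divides by n - 1, so n = 0 and n = 1 are treated apart. *)
Lemma sum_sup_half_le x : \sum_(i < n) (V x - Vbut i x) <= V x.
Proof.
rewrite sumrB sumr_const card_ord -mulr_natl lerBlDr -lerBlDl.
have [nE|n0] := posnP n.
  have -> : n%:R = 0 :> R by rewrite nE.
  rewrite mul0r sub0r; apply: (@le_trans _ _ 0).
    by rewrite oppr_le0; exact: sup_real_ge0.
  by apply: sumr_ge0 => i _; exact: sup_real_ge0.
rewrite -{2}[V x]mul1r -mulrBl.
have n1 : 0 <= n%:R - 1 :> R by rewrite subr_ge0 ler1n.
have [n1'|n1'] := eqVneq (n%:R - 1 : R) 0.
  by rewrite n1' mul0r sumr_ge0// => i _; exact: sup_real_ge0.
have n1gt : 0 < n%:R - 1 :> R by rewrite lt_def n1' n1.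
rewrite mulrC -ler_pdivlMr//; apply: sup_real_le => f g Gf Gg.
rewrite ler_pdivlMr// mulrBr mulr1 lerBlDr.
have -> : process half_weight f g x * n%:R =
    \sum_(i < n) process (half_weight_but i) f g x + process half_weight f g x.
  transitivity (\sum_(i < n) process half_weight f g x).
    by rewrite sumr_const card_ord mulr_natr.
  under eq_bigr => i _ do rewrite (process_split i).
  by rewrite big_split.
by rewrite lerD2r; apply: ler_sum => i _; exact: process_le_sup.
Qed.

Lemma sup_half_but_set i x y : Vbut i (tuple_set x i y) = Vbut i x.
Proof.
rewrite /Vbut /sup_real; congr fine; rewrite /sup_process.
suff h f g : process (half_weight_but i) f g (tuple_set x i y) =
    process (half_weight_but i) f g x.
  by congr ereal_sup; apply/seteqP; split => _ [f Gf [g Gg <-]];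
     exists f => //; exists g => //; rewrite -!/(process _ _ _ _) h.
apply: eq_bigr => j _; rewrite /half_weight_but; case: eqVneq => [->|ji].
  by rewrite !mul0r.
by rewrite tnth_mktuple (negbTE ji).
Qed.

Variable s2 : R.
Hypothesis s20 : 0 <= s2.
Hypothesis var_le : forall f g, G f -> G g ->
  mean P (fun y => (f y - g y) ^+ 2) - mean P (fun y => f y - g y) ^+ 2 <= s2.

Lemma mean_centered_sqr f g : G f -> G g ->
  mean P (fun y => (2^-1 * centered f g y) ^+ 2) <= s2 / 4.
Proof.
move=> Gf Gg; have b := bounded_mfun_classB Gf Gg.
have b2 : bounded_mfun (fun y => (f y - g y) ^+ 2).
  by under eq_fun do rewrite expr2; exact: bounded_mfunM.
have := var_le Gf Gg.
rewrite -[mean P (fun y => f y - g y)]/(mean P (f \- g)).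
set m := mean P (f \- g) => v.
rewrite (_ : (fun y => _) = (fun y => 4^-1 * (f y - g y) ^+ 2 +
    (- (2^-1 * m) * (f \- g) y + 4^-1 * m ^+ 2))).
  rewrite meanD; try bounded_mfun_tac.
  rewrite meanD ?meanZl ?mean_cst; try bounded_mfun_tac.
  by rewrite -/m; lra.
by apply/funext => y; rewrite /centered -/m /=; field.
Qed.

(** Tensorization reduces to one coordinate, where [entropy_coordinate_le] applies with v the
    leave-one-out supremum. Summing over i, the terms V - V_i are absorbed by [sum_sup_half_le]. *)
Lemma entropy_sup_le l : 0 < l ->
  entropy (tuple_law P n) (fun x => expR (l * V x)) <=
  l ^+ 2 / 2 * (n%:R * (s2 / 4)) * mean (tuple_law P n) (fun x => expR (l * V x)) +
  l ^+ 2 * mean (tuple_law P n) (fun x => V x * expR (l * V x)).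
Proof.
move=> l0.
have bV : bounded_mfun V by exact: bounded_mfun_sup_real.
have bVb i : bounded_mfun (Vbut i) by exact: bounded_mfun_sup_real.
have bE : bounded_mfun (fun x => expR (l * V x)) by bounded_mfun_tac.
pose B i x := (l ^+ 2 / 2 * (s2 / 4) + l ^+ 2 * (V x - Vbut i x)) * expR (l * V x).
have bB i : bounded_mfun (B i) by have := bVb i => ?; bounded_mfun_tac.
have m1 x : 1 <= expR (l * V x).
  by rewrite -[leLHS]expR0 ler_expR mulr_ge0 ?sup_real_ge0// ltW.
have key i x : entropy P (fun y => expR (l * V (tuple_set x i y))) <=
    mean P (fun y => B i (tuple_set x i y)).
  rewrite /B.
  under [X in _ <= mean P X]eq_fun do rewrite sup_half_but_set.
  apply: entropy_coordinate_le => //.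
  - exact: bounded_mfun_comp (measurable_tuple_set x i) bV.
  - move=> y; rewrite -(sup_half_but_set i x y).
    by have := sup_half_le i (tuple_set x i y); lra.
  - by rewrite divr_ge0.
  - move=> e e0.
    (* The pair nearly maximizes the leave-one-out process, which does not see the i-th coordinate,
       so one pair serves every resampled value y. *)
    have [f [g [Gf Gg h]]] : exists f g, [/\ G f, G g &
        Vbut i x - e < process (half_weight_but i) f g x].
      by apply: sup_real_adherent; rewrite ltrBlDr ltrDl.
    exists (fun y => 2^-1 * centered f g y).
    have bc := bounded_mfun_centered Gf Gg.
    split.
    - by bounded_mfun_tac.
    - by rewrite meanZl// mean_centered// mulr0.
    - exact: mean_centered_sqr.
    - move=> y.
      have := process_le_sup half_weight (tuple_set x i y) Gf Gg.
      rewrite (process_split i) tnth_mktuple eqxx -/V.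
      have -> : process (half_weight_but i) f g (tuple_set x i y) =
          process (half_weight_but i) f g x.
        apply: eq_bigr => j _; rewrite /half_weight_but; case: eqVneq => [->|ji].
          by rewrite !mul0r.
        by rewrite tnth_mktuple (negbTE ji).
      by lra.
apply: le_trans (entropy_tuple_law_le ltr01 m1 bE bB key) _.
rewrite -mean_sum// -!meanZl -?meanD; try bounded_mfun_tac.
apply: le_mean; try bounded_mfun_tac.
  exact: bounded_mfun_sum.
move=> x; rewrite /B -mulr_suml big_split/= sumr_const card_ord -mulr_sumr.
rewrite -mulr_natl.
have p : 0 <= l ^+ 2 * expR (l * V x) by rewrite mulr_ge0 ?sqr_ge0 ?expR_ge0.
by have := ler_wpM2l p (sum_sup_half_le x); rewrite -/V -/Vbut; lra.
Qed.

End SupProcess.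

Lemma chernoff_mean (R : realType) (d : measure_display) (T : measurableType d)
    (P : probability T R) (V : T -> R) (l s : R) : bounded_mfun V -> 0 < l ->
  (P [set x | (s <= V x)%R] <=
   (expR (ln (mean P (fun x => expR (l * V x))) - l * s))%:E)%E.
Proof.
move=> bV l0; have bE : bounded_mfun (fun x => expR (l * V x)) by bounded_mfun_tac.
have mV : V \in mfun by rewrite inE; case: bV.
have := @chernoff _ _ _ P (mfun_Sub mV) l s l0; move=> /le_trans; apply.
have E0 : 0 < mean P (fun x => expR (l * V x)).
  have [_ [M MV]] := bV.
  apply: (@lt_le_trans _ _ (expR (- (l * M)))); first exact: expR_gt0.
  apply: mean_ge => // x; rewrite ler_expR -mulrN ler_wpM2l ?(ltW l0)//.
  by have := MV x; rewrite ler_norml => /andP[].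
rewrite expRB lnK ?posrE// -expRN EFinM EFin_mean// lee_wpmul2r ?lee_fin ?expR_ge0//.
rewrite /mmt_gen_fun unlock; under eq_integral do rewrite /= mulrC.
exact: lexx.
Qed.

(* Chernoff exponent: [l = 1/2] if [r <= 16 s], and [l = 4 s / r] otherwise. *)
Lemma log_laplace_tail_exponent (R : realType) (L : R -> R) (a r s : R) :
  0 <= a -> 0 <= r -> 0 < s ->
  (forall l, 0 < l <= 2^-1 -> L l <= l / (1 - l) * (a + l * (r ^+ 2 / 4) / 2)) ->
  exists2 l, 0 < l & L l - l * (4 * a + 2 * r * s + 2 * s ^+ 2) <= - s ^+ 2.
Proof.
move=> a0 r0 s0 HL; have [rs|rs] := leP r (16 * s).
  (* At l = 1/2 the bound on L is a + r^2 / 16, and r <= 16 s gives r^2 / 16 <= r s. *)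
  exists 2^-1; first by rewrite invr_gt0.
  have := HL 2^-1; rewrite invr_gt0 ltr0n lexx => /(_ isT).
  have -> : 2^-1 / (1 - 2^-1) = 1 :> R by field.
  by have : r * r <= r * (16 * s) by [exact: ler_wpM2l]; lra.
have r_gt0 : 0 < r by apply: le_lt_trans rs; rewrite mulr_ge0// ltW.
pose l := 4 * s / r; have l0 : 0 < l by rewrite divr_gt0// mulr_gt0.
have l4 : l < 4^-1 by rewrite ltr_pdivrMr//; lra.
exists l => //; have := HL l; rewrite l0 (le_trans (ltW l4)) ?lef_pV2 ?posrE ?ler_nat//.
move=> /(_ isT) h.
have lr : l * r = 4 * s by rewrite /l divfK ?gt_eqF.
have : L l <= 4 / 3 * l * (a + l * (r ^+ 2 / 4) / 2).
  apply: le_trans h _; apply: ler_wpM2r.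
    by rewrite addr_ge0// divr_ge0// mulr_ge0 ?(ltW l0)// divr_ge0// sqr_ge0.
  by rewrite ler_pdivrMr; [nra|lra].
have -> : 4 / 3 * l * (a + l * (r ^+ 2 / 4) / 2) =
  4 / 3 * l * a + (l * r) * (l * r) / 6 by field.
have -> : l * (4 * a + 2 * r * s + 2 * s ^+ 2) =
  4 * (l * a) + 2 * (l * r) * s + 2 * l * s ^+ 2 by ring.
rewrite lr; have := mulr_ge0 (ltW l0) a0.
have : 0 <= l * s ^+ 2 by rewrite mulr_ge0 ?sqr_ge0// ltW.
by have := sqr_ge0 s; lra.
Qed.

(** * Deviation bound for the empirical process *)

Section Tail.
Context (R : realType) (d : measure_display) (S : measurableType d)
  (P : probability S R) (n : nat) (G : set (S -> R)).
Hypothesis G0 : G !=set0.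
Hypothesis G01 : forall f, G f -> measurable_fun [set: S] f /\ forall x, 0 <= f x <= 1.
Hypothesis mG : measurable_suprema P n G.
Variable s2 : R.
Hypothesis s20 : 0 <= s2.
Hypothesis var_le : forall f g, G f -> G g ->
  mean P (fun y => (f y - g y) ^+ 2) - mean P (fun y => f y - g y) ^+ 2 <= s2.

Local Notation V := (sup_real P G (@half_weight R n)).
Local Notation Q := (tuple_law P n).

(** For F the Laplace transform of V, x F'(x) - F(x) ln F(x) is the entropy of exp (x V), so
    [entropy_sup_le] is the differential inequality that [log_laplace_le] integrates, with v = n s2
    / 4. *)
Lemma log_laplace_sup_le l : 0 < l < 1 ->
  ln (mean Q (fun x => expR (l * V x))) <=
  l / (1 - l) * (mean Q V + l * (n%:R * (s2 / 4)) / 2).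
Proof.
move=> /andP[l0 l1].
have bV : bounded_mfun V by exact: bounded_mfun_sup_real.
have bE x : bounded_mfun (fun y => expR (x * V y)) by bounded_mfun_tac.
pose M := (\sum_(i < n) `|@half_weight R n i|) * 2.
have VM x : 0 <= V x <= M by rewrite sup_real_ge0// sup_real_bounded.
apply: (@log_laplace_le _ (fun x => mean Q (fun y => expR (x * V y)))
  (fun x => mean Q (fun y => V y * expR (x * V y))) _ _ (M ^+ 2 * expR M)).
- by rewrite l0.
- by rewrite mulr_ge0// divr_ge0.
- by apply: mean_ge => // x; have /andP[] := VM x.
- by rewrite mulr_ge0 ?sqr_ge0 ?expR_ge0.
- by move=> x _; exact: is_derive_laplace.
- move=> x /andP[x0 _]; apply: lt_le_trans ltr01 _; apply: mean_ge => // y.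
  rewrite -[leLHS]expR0 ler_expR mulr_ge0 ?(ltW x0)//.
  by have /andP[] := VM y.
- move=> x /andP[x0 _].
  have := entropy_sup_le G0 G01 mG s20 var_le x0.
  rewrite /entropy; under eq_fun do rewrite expRK.
  rewrite [X in mean Q X - _ <= _](_ : _ = (fun y => x * (V y * expR (x * V y)))); last first.
    by apply/funext => y; ring.
  by rewrite meanZl//; bounded_mfun_tac.
- move=> x /andP[x0 xl]; apply: ln_laplace_le => //.
  by rewrite x0 (le_trans xl (ltW l1)).
Qed.

Lemma sup_half_tail (r s : R) : 0 <= r -> r ^+ 2 = n%:R * s2 -> 0 < s ->
  (Q [set x | (4 * mean Q V + 2 * r * s + 2 * s ^+ 2 <= V x)%R] <=
   (expR (- s ^+ 2))%:E)%E.
Proof.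
move=> r0 rE s0.
have bV : bounded_mfun V by exact: bounded_mfun_sup_real.
have a0 : 0 <= mean Q V by apply: mean_ge => // x; exact: sup_real_ge0.
have [l l0 hl] : exists2 l, 0 < l & ln (mean Q (fun x => expR (l * V x))) -
    l * (4 * mean Q V + 2 * r * s + 2 * s ^+ 2) <= - s ^+ 2.
  apply: log_laplace_tail_exponent => // l /andP[l0 l2].
  rewrite rE -[n%:R * s2 / 4]mulrA; apply: log_laplace_sup_le.
  by rewrite l0 (le_lt_trans l2)// invf_lt1// ltr1n.
apply: le_trans (chernoff_mean Q _ bV l0) _.
by rewrite lee_fin ler_expR.
Qed.

Lemma sup_real_cst (c : R) x : 0 <= c ->
  sup_real P G (fun=> c) x = 2 * c * V x.
Proof.
have pE f g : process P (fun=> c) f g x = 2 * c * process P (@half_weight R n) f g x.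
  by rewrite /process mulr_sumr; apply: eq_bigr => i _; rewrite /half_weight; field.
rewrite le_eqVlt => /predU1P[c0|c0].
  rewrite -c0 mulr0 mul0r; apply/eqP; rewrite eq_le sup_real_ge0// andbT.
  by apply: sup_real_le => // f g _ _; rewrite c0 pE -c0 mulr0 mul0r.
have c20 : 0 < 2 * c by rewrite mulr_gt0.
apply/eqP; rewrite eq_le; apply/andP; split.
  apply: sup_real_le => // f g Gf Gg; rewrite pE.
  by rewrite ler_wpM2l ?(ltW c20)// process_le_sup.
rewrite mulrC -ler_pdivlMr//; apply: sup_real_le => // f g Gf Gg.
by rewrite ler_pdivlMr// mulrC -pE process_le_sup.
Qed.

Context (d' : measure_display) (Omega : measurableType d') (Pr : probability Omega R).
Context (X : 'I_n -> {mfun Omega >-> S}).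
Hypotheses (n0 : (0 < n)%N) (iX : iid_sample P Pr X).

Lemma emp_meanB_process f g w :
  emp_mean X w (f \- g) - mean P (f \- g) = process P (fun=> n%:R^-1) f g (sample X w).
Proof.
have -> : process P (fun=> n%:R^-1) f g (sample X w) =
    n%:R^-1 * \sum_(i < n) ((f \- g) (X i w) - mean P (f \- g)).
  rewrite /process -mulr_sumr; congr (_ * _).
  by apply: eq_bigr => i _; rewrite tnth_mktuple.
rewrite sumrB mulrBr sumr_const card_ord -[mean _ _ *+ n]mulr_natl.
by rewrite mulKf ?pnatr_eq0 -?lt0n.
Qed.

Lemma integral_emp_process : (\int[Pr]_w ereal_sup
     [set `|emp_mean X w (f \- g) - mean P (f \- g)|%:E | f in G & g in G])%E =
  (2 / n%:R * mean Q V)%:E.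
Proof.
have bV : bounded_mfun V by exact: bounded_mfun_sup_real.
have bVX : bounded_mfun (V \o sample X).
  by apply: bounded_mfun_comp bV; exact: measurable_sample.
have n1 : 0 <= n%:R^-1 :> R by rewrite invr_ge0.
rewrite (eq_integral (fun w => (2 / n%:R * V (sample X w))%:E)); last first.
  move=> w _; rewrite -sup_real_cst// -sup_processE//; congr ereal_sup.
  by apply/seteqP; split => _ [f Gf [g Gg <-]]; exists f => //; exists g => //;
    rewrite emp_meanB_process.
rewrite -EFin_mean; last by bounded_mfun_tac.
by rewrite meanZl//; rewrite -(mean_sample iX bV).
Qed.

(** With r = sig sqrt n and s = sqrt t, the threshold of [sup_half_tail] times 2 / n is exactly
    twice the expression bounded by u. The exceptional event is pulled back from the sample
    space. *)
Lemma emp_process_tail (sig t u : R) : 0 <= sig -> sig ^+ 2 = s2 -> 0 < t ->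
  (2%:E * (\int[Pr]_w ereal_sup
     [set `|emp_mean X w (f \- g) - mean P (f \- g)|%:E | f in G & g in G]
     + (sig * Num.sqrt (t / n%:R))%:E + (t / n%:R)%:E) <= u%:E)%E ->
  exists B, [/\ measurable B, (Pr B <= (expR (- t))%:E)%E &
    forall w, ~ B w -> forall f g, G f -> G g ->
      emp_mean X w (f \- g) - mean P (f \- g) <= 2 * u].
Proof.
move=> sig0 sigE t0; rewrite integral_emp_process -!EFinD -EFinM lee_fin => hu.
have nR : 0 < n%:R :> R by rewrite ltr0n.
have bV : bounded_mfun V by exact: bounded_mfun_sup_real.
pose r := sig * Num.sqrt n%:R; pose s := Num.sqrt t.
have s0 : 0 < s by rewrite sqrtr_gt0.
have r0 : 0 <= r by rewrite mulr_ge0.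
have rE : r ^+ 2 = n%:R * s2 by rewrite exprMn sqr_sqrtr ?(ltW nR)// sigE mulrC.
have sE : s ^+ 2 = t by rewrite sqr_sqrtr// ltW.
pose A := [set x | 4 * mean Q V + 2 * r * s + 2 * s ^+ 2 <= V x].
have mA : measurable A.
  rewrite -[A]setTI.
  rewrite (_ : A = V @^-1` `[4 * mean Q V + 2 * r * s + 2 * s ^+ 2, +oo[%classic).
    by case: bV => mV _; exact: mV.
  by apply/seteqP; split => x; rewrite /A /= in_itv/= andbT.
exists (sample X @^-1` A); split.
- by rewrite -[X in measurable X]setTI; exact: measurable_sample.
- have := distribution_sample iX mA; rewrite /distribution /pushforward => ->.
  by rewrite -sE; exact: sup_half_tail.
move=> w nB f g Gf Gg; rewrite emp_meanB_process.
have := process_le_sup P G0 G01 (fun=> n%:R^-1) (sample X w) Gf Gg.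
move=> /le_trans; apply.
rewrite sup_real_cst ?invr_ge0//.
have : V (sample X w) < 4 * mean Q V + 2 * r * s + 2 * s ^+ 2.
  by rewrite ltNge; apply/negP.
have rs : r * s = n%:R * (sig * Num.sqrt (t / n%:R)).
  rewrite sqrtrM ?(ltW t0)// sqrtrV ?(ltW nR)// /r /s.
  rewrite -{2}(sqr_sqrtr (ltW nR)); field.
  by rewrite gt_eqF// sqrtr_gt0.
have tn : t = n%:R * (t / n%:R) by rewrite mulrC divfK ?gt_eqF.
rewrite sE -[2 * r * s]mulrA rs {2}tn => h.
rewrite mulrAC ler_pdivrMr//; move: (ltW h) => {}h.
have h2 := ler_wpM2l (ler0n R 2) h; apply: le_trans h2 _.
have := ler_wpM2r (ltW nR) hu.
have -> : 2 * (2 / n%:R * mean Q V + sig * Num.sqrt (t / n%:R) + t / n%:R) * n%:R =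
  4 * mean Q V + 2 * (n%:R * (sig * Num.sqrt (t / n%:R))) + 2 * (n%:R * (t / n%:R)).
  by field; rewrite gt_eqF.
lra.
Qed.

End Tail.

(** * Geometric levels and infima of indices *)

Lemma bounded_mfun_Lfun2 (R : realType) (d : measure_display) (T : measurableType d)
    (P : probability T R) (f : T -> R) : bounded_mfun f -> f \in Lfun P 2%:E.
Proof.
move=> [mf [M Mf]]; rewrite inE; apply/andP; split; first by rewrite inE.
rewrite inE /= /finite_norm unlock /=; apply: poweR_lty.
apply: (@le_lt_trans _ _ (\int[P]_x (cst (M ^+ 2)%:E x))%E).
  apply: ge0_le_integral => //.
  - apply/measurable_EFinP; apply: (measurableT_comp (measurable_powR _)) => //.
    exact: measurableT_comp.
  - move=> x _ /=; rewrite lee_fin (powR_mulrn 2)// lerXn2r ?nnegrE//.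
    exact: le_trans (Mf x).
rewrite integral_cst// [X in (_ * X)%E](_ : _ = 1%E) ?mule1 ?ltry//.
exact: probability_setT.
Qed.

Section GeometricLevels.
Context (R : realType) (q : R).
Hypothesis q1 : 1 < q.

Let q0 : 0 < q. Proof. exact: lt_trans q1. Qed.

Let lnq0 : 0 < ln q. Proof. by rewrite ln_gt0. Qed.

Lemma exprn_le_ln (j : nat) (x : R) : 0 < x -> (q ^+ j <= x) = (j%:R <= ln x / ln q).
Proof.
move=> x0; rewrite ler_pdivlMr// -ler_ln ?posrE ?exprn_gt0//.
by rewrite lnXn// mulr_natl.
Qed.

Lemma geometric_level (e : R) : 0 < e <= 1 -> exists j : nat, q ^- j.+1 < e <= q ^- j.
Proof.
move=> /andP[e0 e1]; have ei : 0 < e^-1 by rewrite invr_gt0.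
have x0 : 0 <= ln e^-1 / ln q by rewrite divr_ge0 ?(ltW lnq0)// ln_ge0// invf_ge1.
exists (Num.truncn (ln e^-1 / ln q)).
have := truncn_itv x0; move: (Num.truncn _) => j /andP[h1 h2].
rewrite -[e]invrK ltf_pV2 ?posrE ?exprn_gt0// lef_pV2 ?posrE ?exprn_gt0//.
by rewrite ltNge !exprn_le_ln// -ltNge h1 h2.
Qed.

End GeometricLevels.

Lemma index_infP (A : set nat) k : index_inf A = Some k ->
  A k /\ forall m, A m -> (k <= m)%N.
Proof.
rewrite /index_inf; case: pselect => // exA [<-].
by case: ex_minnP => m /asboolP Am h; split => // l Al; apply: h; exact/asboolP.
Qed.

Lemma index_inf_ex (A : set nat) k : A k -> exists l, index_inf A = Some l.
Proof.
move=> Ak; rewrite /index_inf; case: pselect => [exA|[]]; first by exists (ex_minn exA).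
by exists k; exact/asboolP.
Qed.

Section MaxUpto.
Context (R : realType).
Implicit Types u v : nat -> \bar R.

Lemma le_max_upto u j k : (1 <= j <= k)%N -> (u j <= max_upto u k)%E.
Proof. by move=> jk; apply: le_bigmax_seq => //; rewrite mem_index_iota. Qed.

Lemma max_upto_le u k (x : \bar R) : (forall j, (1 <= j <= k)%N -> (u j <= x)%E) ->
  (max_upto u k <= x)%E.
Proof.
move=> ux; rewrite /max_upto big_seq; apply: bigmax_le => //; first exact: leNye.
by move=> j; rewrite mem_index_iota => jk; exact: ux.
Qed.

Lemma max_upto_mono u v k : (forall j, (1 <= j <= k)%N -> (u j <= v j)%E) ->
  (max_upto u k <= max_upto v k)%E.
Proof.
move=> uv; apply: max_upto_le => j jk; apply: le_trans (uv _ jk) _.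
exact: le_max_upto.
Qed.

(* Otherwise [u] would drop by [c] infinitely often. *)
Lemma ex_no_drop (u : nat -> R) (D : nat -> \bar R) (c : R) : 0 < c ->
  (forall k, (1 <= k)%N -> 0 <= u k <= 1) ->
  (forall k, (1 <= k)%N -> (c%:E <= D k)%E) ->
  exists k, (1 <= k)%N /\ forall l, (k < l)%N -> ((u k - u l)%:E <= D l)%E.
Proof.
move=> c0 u01 cD; apply: contrapT => hN.
have drop k : (1 <= k)%N -> exists2 l, (1 <= l)%N & c < u k - u l.
  move=> k1; apply: contrapT => hk; apply: hN; exists k; split => // l kl.
  have l1 := leq_ltn_trans (leq0n k) kl.
  apply: le_trans (cD l l1); rewrite lee_fin leNgt; apply/negP => cu.
  by apply: hk; exists l.
have drops m : exists2 k, (1 <= k)%N & m%:R * c <= u 1 - u k.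
  elim: m => [|m [k k1 IH]]; first by exists 1%N => //; rewrite mul0r subrr.
  have [l l1 cl] := drop k k1; exists l => //.
  by rewrite -natr1 mulrDl mul1r; lra.
(* More than 1 / c drops of size c exceed the range [0, 1]. *)
have [k k1] := drops (Num.truncn c^-1).+1.
have := u01 k k1; have := u01 1%N isT; have := truncnS_gt c^-1.
by rewrite -(ltr_pM2r c0) mulVf ?gt_eqF//; lra.
Qed.

End MaxUpto.

(** * Ratio inequalities for the excess risk *)

Section RiskClass.
Context (R : realType) (d d' : measure_display) (S : measurableType d)
  (P : probability S R) (Omega : measurableType d') (Pr : probability Omega R)
  (n : nat) (X : 'I_n -> {mfun Omega >-> S})
  (rho : (S -> R) -> (S -> R) -> R) (G : set (S -> R)).
Hypothesis G0 : G !=set0.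
Hypothesis G01 : forall f, G f -> measurable_fun [set: S] f /\ forall x, 0 <= f x <= 1.

Let bG f : G f -> bounded_mfun f.
Proof. exact: bounded_mfun_class. Qed.

Lemma mean_class01 f : G f -> 0 <= mean P f <= 1.
Proof.
move=> Gf; have [_ f01] := G01 Gf; rewrite mean_ge ?mean_le//; try exact: bG.
  by move=> x; case/andP: (f01 x).
by move=> x; case/andP: (f01 x).
Qed.

Lemma inf_mean_le f : G f -> inf_mean P G <= mean P f.
Proof.
move=> Gf; apply: ge_inf; last by exists f.
by exists 0 => _ [g Gg <-]; case/andP: (mean_class01 Gg).
Qed.

Lemma inf_mean_ge c : (forall f, G f -> c <= mean P f) -> c <= inf_mean P G.
Proof.
move=> h; apply: lb_le_inf; first by have [f Gf] := G0; exists (mean P f), f.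
by move=> _ [f Gf <-]; exact: h.
Qed.

Lemma inf_mean_adherent e : 0 < e -> exists2 f, G f & mean P f < inf_mean P G + e.
Proof.
move=> e0; have [|_ [f Gf <-] h] := @inf_adherent _ [set mean P f | f in G] _ e0.
- split; first by have [f Gf] := G0; exists (mean P f), f.
  by exists 0 => _ [g Gg <-]; case/andP: (mean_class01 Gg).
- by exists f.
Qed.

Lemma inf_mean01 : 0 <= inf_mean P G <= 1.
Proof.
rewrite inf_mean_ge/=; last by move=> f /mean_class01/andP[].
by have [f Gf] := G0; apply: le_trans (inf_mean_le Gf) _; case/andP: (mean_class01 Gf).
Qed.

Lemma near_min_nonempty delta : 0 < delta -> near_min P G delta !=set0.
Proof.
move=> /inf_mean_adherent[f Gf h]; exists f; split => //.
by rewrite lerBlDl ltW.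
Qed.

Lemma mean_classB f g : G f -> G g -> mean P (f \- g) = mean P f - mean P g.
Proof. by move=> /bG bf /bG bg; exact: meanB. Qed.

Lemma emp_meanB w (f g : S -> R) : emp_mean X w (f \- g) = emp_mean X w f - emp_mean X w g.
Proof. by rewrite /emp_mean -mulrBr -sumrB. Qed.

Lemma emp_mean01 w (f : S -> R) : (0 < n)%N -> G f -> 0 <= emp_mean X w f <= 1.
Proof.
move=> n0 Gf; have [_ f01] := G01 Gf.
have nR : 0 < n%:R :> R by rewrite ltr0n.
rewrite mulr_ge0 ?invr_ge0 ?sumr_ge0//=; last by move=> i _; case/andP: (f01 (X i w)).
rewrite ler_pdivrMl// mulr1; apply: le_trans (_ : \sum_(i < n) 1 <= _).
  by apply: ler_sum => i _; case/andP: (f01 (X i w)).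
by rewrite sumr_const card_ord.
Qed.

Hypothesis hrho : dominates_variance P rho.

Lemma rho_ge0 f g : G f -> G g -> 0 <= rho f g.
Proof.
move=> /bG bf /bG bg.
by have [] := hrho (bounded_mfun_Lfun2 P bf) (bounded_mfun_Lfun2 P bg).
Qed.

Lemma diam_ge0 delta : 0 < delta -> (0 <= diam P rho G delta)%E.
Proof.
move=> /near_min_nonempty[f [Gf fd]].
apply: le_trans (_ : (rho f f)%:E <= _)%E; first by rewrite lee_fin rho_ge0.
by apply: ereal_sup_ubound; exists f => //; exists f.
Qed.

Lemma phi_ge0 delta : 0 < delta -> (0 <= phi P Pr X G delta)%E.
Proof.
move=> /near_min_nonempty[f fd]; apply: integral_ge0 => w _.
apply: le_trans (_ : `|emp_mean X w (f \- f) - mean P (f \- f)|%:E <= _)%E.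
  by rewrite lee_fin.
by apply: ereal_sup_ubound; exists f => //; exists f.
Qed.

Variables (q t : R).
Hypotheses (q1 : 1 < q) (n0 : (0 < n)%N) (t0 : 0 < t).

Let q0 : 0 < q. Proof. exact: lt_trans q1. Qed.
Let nR : 0 < n%:R :> R. Proof. by rewrite ltr0n. Qed.
Let qj0 j : 0 < q ^- j. Proof. by rewrite invr_gt0 exprn_gt0. Qed.

Local Notation dbar := (delta_bar P Pr q X rho G t).

(** The other two terms are nonnegative on a nonempty level set. This floor limits the number of
    levels above [dbar] and keeps [dbar] away from 0. *)
Lemma Ubar_ge delta : 0 < delta -> ((2 * (t / n%:R))%:E <= Ubar P Pr X rho G t delta)%E.
Proof.
move=> d0; rewrite EFinM; apply: lee_wpmul2l => //; apply: leeDr.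
by rewrite adde_ge0 ?phi_ge0// mule_ge0 ?diam_ge0// lee_fin sqrtr_ge0.
Qed.

Lemma flat_transform_le (psi : R -> \bar R) delta e j : delta <= q ^- j ->
  (flat_transform q psi delta <= e%:E)%E -> (psi (q ^- j) <= (e * q ^- j)%:E)%E.
Proof.
move=> dj; rewrite EFinM -lee_pdivrMr//; apply: le_trans.
by apply: ereal_sup_ubound; exists (Posz j) => //; rewrite /= -exprnN.
Qed.

Lemma Ubar_le j : (dbar < (q ^- j)%:E)%E ->
  (Ubar P Pr X rho G t (q ^- j) <= (q ^- j / (2 * q ^+ 3))%:E)%E.
Proof.
move=> /ereal_inf_lt[_ [delta [_ hd] <-]]; rewrite lte_fin => dj.
by rewrite [q ^- j / _]mulrC; exact: flat_transform_le (ltW dj) hd.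
Qed.

(** Once q^-J / (2 q^3) < 2 t / n, the ratio of [Ubar] to the level q^-J exceeds the threshold 1 /
    (2 q^3), so no delta <= q^-J competes in the infimum defining [dbar]. *)
Lemma level_le_dbar : exists J : nat, ((q ^- J)%:E <= dbar)%E.
Proof.
pose e := (2 * q ^+ 3)^-1; pose a := 2 * (t / n%:R).
have e0 : 0 < e by rewrite invr_gt0 mulr_gt0// exprn_gt0.
have a0 : 0 < a by rewrite mulr_gt0// divr_gt0.
have [J hJ] : exists J, q ^- J * e < a.
  pose m := Num.min 1 (a / e); have m0 : 0 < m by rewrite lt_min ltr01 divr_gt0.
  have [|j /andP[hj _]] := @geometric_level _ _ q1 m; first by rewrite m0 ge_min lexx.
  exists j.+1; rewrite -ltr_pdivlMr//; apply: lt_le_trans hj _.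
  by rewrite ge_min lexx orbT.
exists J; apply: le_ereal_inf_tmp => _ [delta [d0 hd] <-].
rewrite lee_fin leNgt; apply/negP => /ltW dJ.
have := le_trans (Ubar_ge (qj0 J)) (flat_transform_le dJ hd).
by rewrite lee_fin -/a -/e; lra.
Qed.

Hypothesis iX : iid_sample P Pr X.
Hypothesis mG : forall delta, 0 < delta -> measurable_suprema P n (near_min P G delta).

(** The bound q^-j / q^3 is twice the value that [Ubar] may take at a level above [dbar]. Natural
    exponents j suffice, since excess risks are at most 1. *)
Definition ratio_event (w : Omega) := forall j : nat, (dbar < (q ^- j)%:E)%E ->
  forall f g, near_min P G (q ^- j) f -> near_min P G (q ^- j) g ->
  emp_mean X w (f \- g) - mean P (f \- g) <= q ^- j / q ^+ 3.

(** The condition on the level stands inside the existential so that an exceptional set can be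
    chosen for every j; it is empty at levels not above [dbar]. *)
Lemma level_tail j : exists B, [/\ measurable B, (Pr B <= (expR (- t))%:E)%E &
  (dbar < (q ^- j)%:E)%E -> forall w, ~ B w ->
  forall f g, near_min P G (q ^- j) f -> near_min P G (q ^- j) g ->
  emp_mean X w (f \- g) - mean P (f \- g) <= q ^- j / q ^+ 3].
Proof.
have [hj|hj] := boolP (dbar < (q ^- j)%:E)%E; last first.
  by exists set0; split => //; rewrite measure0 lee_fin expR_ge0.
have hU := Ubar_le hj.
have sq0 : 0 < Num.sqrt (t / n%:R) by rewrite sqrtr_gt0 divr_gt0.
(* An infinite diameter would make [Ubar] infinite, against [hU]. *)
have [sig sE] : exists sig, diam P rho G (q ^- j) = sig%:E.
  have := diam_ge0 (qj0 j); case E : (diam P rho G (q ^- j)) => [r| |] // _.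
    by exists r.
  move: hU; rewrite /Ubar E gt0_mulye ?lte_fin// addey; last first.
    by rewrite gt_eqF// (lt_le_trans _ (phi_ge0 (qj0 j)))// ltNye.
  by rewrite addye// mulry gtr0_sg// mul1e leye_eq.
have sig0 : 0 <= sig by rewrite -lee_fin -sE diam_ge0.
have H01 f : near_min P G (q ^- j) f -> measurable_fun [set: S] f /\ forall x, 0 <= f x <= 1.
  by move=> [/G01].
have var f g : near_min P G (q ^- j) f -> near_min P G (q ^- j) g ->
    mean P (fun y => (f y - g y) ^+ 2) - mean P (fun y => f y - g y) ^+ 2 <= sig ^+ 2.
  move=> fj gj; have [[Gf _] [Gg _]] := (fj, gj).
  have [r0 h] := hrho (bounded_mfun_Lfun2 P (bG Gf)) (bounded_mfun_Lfun2 P (bG Gg)).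
  apply: le_trans h _; rewrite lerXn2r ?nnegrE// -lee_fin -sE.
  by apply: ereal_sup_ubound; exists f => //; exists g.
have := @emp_process_tail _ _ _ P n _ (near_min_nonempty (qj0 j)) H01 (mG (qj0 j))
  (sig ^+ 2) (sqr_ge0 _) var _ _ Pr X n0 iX sig t (q ^- j / (2 * q ^+ 3)) sig0 erefl t0.
move: hU; rewrite /Ubar sE -EFinM => hU /(_ hU) [B [mB PB hB]].
exists B; split => // _ w Bw f g fj gj; apply: le_trans (hB _ Bw f g fj gj) _.
rewrite le_eqVlt; apply/orP; left; apply/eqP.
by field; rewrite !gt_eqF ?exprn_gt0.
Qed.

(** From 2 t / n <= [Ubar] <= q^-j / (2 q^3) one gets 4 q^3 q^j t <= n, hence q^(j+1) <= q^2 n / t.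
    The exponent j + 1 is what counts the levels 0, ..., j. *)
Lemma level_lt_truncn j : (dbar < (q ^- j)%:E)%E ->
  (j < Num.truncn (Num.max (ln (q ^+ 2 * n%:R / t) / ln q) 0)%R)%N.
Proof.
move=> /Ubar_le/(le_trans (Ubar_ge (qj0 j))); rewrite lee_fin => h.
rewrite truncn_gt_nat le_max -exprn_le_ln ?divr_gt0 ?mulr_gt0 ?exprn_gt0//.
apply/orP; left.
have c0 : 0 <= n%:R * q ^+ j * (2 * q ^+ 3).
  by rewrite !mulr_ge0 ?exprn_ge0// ltW.
have := ler_wpM2r c0 h.
have -> : 2 * (t / n%:R) * (n%:R * q ^+ j * (2 * q ^+ 3)) = 4 * q ^+ 3 * (q ^+ j * t).
  by field; rewrite gt_eqF.
have -> : q ^- j / (2 * q ^+ 3) * (n%:R * q ^+ j * (2 * q ^+ 3)) = n%:R.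
  by field; rewrite !gt_eqF ?exprn_gt0.
move=> {}h; rewrite ler_pdivlMr// exprS -mulrA.
have y0 : 0 <= q ^+ j * t by rewrite mulr_ge0 ?exprn_ge0// ltW.
apply: le_trans (_ : 4 * q ^+ 3 * (q ^+ j * t) <= _).
  rewrite ler_wpM2r// [q ^+ 3]exprS mulrCA ler_peMr ?(ltW q0)//.
  by rewrite mulr_ege1 ?exprn_ege1 ?(ltW q1)// ler1n.
by apply: le_trans h _; rewrite ler_peMl ?(ltW nR)// exprn_ege1// ltW.
Qed.

Lemma ratio_event_tail : exists B, [/\ measurable B,
  (Pr B <= (Num.max (ln (q ^+ 2 * n%:R / t) / ln q) 0 * expR (- t))%:E)%E &
  forall w, ~ B w -> ratio_event w].
Proof.
have [B hB] := choice level_tail.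
set x := Num.max _ _; have x0 : 0 <= x by rewrite le_max lexx orbT.
pose N := Num.truncn x.
exists (\big[setU/set0]_(j < N) B j); split.
- by apply: bigsetU_measurable => j _; have [] := hB j.
- apply: le_trans (Boole_inequality _ _) _; first by move=> j _; have [] := hB j.
  apply: (@le_trans _ _ (\sum_(j < N) (expR (- t))%:E)%E).
    by apply: lee_sum => j _; have [] := hB j.
  rewrite sumEFin lee_fin sumr_const card_ord -mulr_natl ler_wpM2r ?expR_ge0//.
  by rewrite truncn_le.
- move=> w; rewrite -bigcup_mkord => nB j hj.
  have [_ _] := hB j; apply => // Bj; apply: nB; exists j => //.
  exact: level_lt_truncn.
Qed.

Context (w : Omega) (fh : S -> R).
Hypothesis hw : ratio_event w.
Hypothesis Gfh : G fh.
Hypothesis min_fh : forall f, G f -> emp_mean X w fh <= emp_mean X w f.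

(** Let e be the excess risk of f and q^-(j+1) < e <= q^-j. Comparing f with a near-minimizer g of
    the true risk in the same level set costs at most q^-j / q^3 <= e q^-2, and [fh] does at least
    as well as g empirically. *)
Lemma excess_le f : G f -> (dbar < (mean P f - inf_mean P G)%:E)%E ->
  (mean P f - inf_mean P G) * (1 - q ^- 2) <= emp_mean X w f - emp_mean X w fh.
Proof.
move=> Gf; set e := mean P f - _ => De.
have e0 : 0 < e.
  have [J hJ] := level_le_dbar.
  by rewrite -lte_fin (lt_trans _ (le_lt_trans hJ De))// lte_fin.
have e1 : e <= 1.
  by have /andP[? ?] := inf_mean01; have /andP[? ?] := mean_class01 Gf; rewrite /e; lra.
have [|j /andP[je ej]] := @geometric_level _ _ q1 e; first by rewrite e0.
have Dj : (dbar < (q ^- j)%:E)%E by apply: lt_le_trans De _; rewrite lee_fin.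
apply/ler_addgt0Pr => eta eta0.
(* The infimum need not be attained: g is both eta-close to it and inside the level set. *)
have [|g Gg hg] := @inf_mean_adherent (Num.min eta (q ^- j)).
  by rewrite lt_min eta0 qj0.
have [hg1 hg2] : mean P g < inf_mean P G + eta /\ mean P g < inf_mean P G + q ^- j.
  split; apply: lt_le_trans hg _; rewrite lerD2l ge_min lexx// orbT//.
have := hw Dj (conj Gg _ : near_min P G (q ^- j) g) (conj Gf ej).
rewrite lerBlDl => /(_ (ltW hg2)).
rewrite emp_meanB mean_classB// => h.
have hfh := min_fh Gg.
have : q ^- j / q ^+ 3 <= e * q ^- 2.
  have -> : q ^- j / q ^+ 3 = q ^- j.+1 * q ^- 2.
    by rewrite -!invfM -!exprD addn3 addn2.
  by rewrite ler_wpM2r ?invr_ge0 ?exprn_ge0// ltW.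
rewrite /e in je ej *; lra.
Qed.

(** Both f and [fh] are placed in one level set slightly above m, where the deviation is at most m;
    the true risks differ by at most m as well. *)
Lemma emp_excess_le f (m : R) : G f -> 0 < m -> (dbar <= m%:E)%E ->
  mean P f - inf_mean P G <= m -> emp_mean X w f - emp_mean X w fh <= 2 * m.
Proof.
move=> Gf m0 Dm fm.
have [m1|m1] := leP 1 m.
  by have /andP[? ?] := emp_mean01 w n0 Gf; have /andP[? ?] := emp_mean01 w n0 Gfh; lra.
(* The factor q^2 > 1 puts the level strictly above m, hence above [dbar], while q^-(j+1) < q^2 m
   still gives q^-j / q^3 <= m. *)
pose m' := Num.min 1 (q ^+ 2 * m).
have q2 : 1 < q ^+ 2 by rewrite exprn_egt1.
have m'1 : m' <= 1 by rewrite ge_min lexx.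
have mm' : m < m' by rewrite lt_min m1 ltr_pMl.
have [|j /andP[jm mj]] := @geometric_level _ _ q1 m'; first by rewrite m'1 (lt_trans m0).
have Dj : (dbar < (q ^- j)%:E)%E.
  by apply: le_lt_trans Dm _; rewrite lte_fin (lt_le_trans mm').
have fhj : mean P fh - inf_mean P G <= q ^- j.
  rewrite leNgt; apply/negP => hj.
  (* Applied to [fh] itself, [excess_le] bounds a positive number by 0. *)
  have := excess_le Gfh; rewrite (lt_trans Dj) ?lte_fin// subrr => /(_ isT).
  apply/negP; rewrite -ltNge; apply: mulr_gt0; first exact: lt_trans hj.
  by rewrite subr_gt0 invf_lt1// exprn_gt0.
have fj : mean P f - inf_mean P G <= q ^- j.
  by rewrite (le_trans fm)// ltW// (lt_le_trans mm').
have := hw Dj (conj Gf fj) (conj Gfh fhj).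
rewrite emp_meanB mean_classB// => h.
have hfh := inf_mean_le Gfh.
have : q ^- j / q ^+ 3 <= m.
  have -> : q ^- j / q ^+ 3 = q ^- j.+1 * q ^- 2.
    by rewrite -!invfM -!exprD addn3 addn2.
  rewrite ler_pdivrMr ?exprn_gt0// mulrC; apply: le_trans (ltW jm) _.
  by rewrite ge_min lexx orbT.
lra.
Qed.

End RiskClass.

(** * Model selection *)

Section ModelSelection.
Context (R : realType) (q : R) (d d' : measure_display) (S : measurableType d)
  (P : probability S R) (Omega : measurableType d') (Pr : probability Omega R)
  (n : nat) (X : 'I_n -> {mfun Omega >-> S})
  (rho : (S -> R) -> (S -> R) -> R) (F : nat -> set (S -> R))
  (fhat : nat -> Omega -> S -> R) (t : nat -> R).
Hypotheses (q1 : 1 < q) (n0 : (0 < n)%N).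
Hypothesis hrho : dominates_variance P rho.
Hypothesis F01 : forall k, (1 <= k)%N -> forall f, F k f ->
  measurable_fun [set: S] f /\ forall x, 0 <= f x <= 1.
Hypothesis F0 : forall k, (1 <= k)%N -> F k !=set0.
Hypothesis FS : forall k, (1 <= k)%N -> F k `<=` F k.+1.
Hypothesis fhatP : forall k w, (1 <= k)%N -> F k (fhat k w) /\
  forall f, F k f -> emp_mean X w (fhat k w) <= emp_mean X w f.
Hypothesis t0 : forall k, (1 <= k)%N -> 0 < t k.

Let q0 : 0 < q. Proof. exact: lt_trans q1. Qed.

Lemma class_mono j k : (1 <= j <= k)%N -> F j `<=` F k.
Proof.
move=> /andP[j1 /subnK <-]; elim: (k - j)%N => [//|m IH].
by apply: subset_trans IH _; rewrite addSn; apply: FS; rewrite addn_gt0 j1 orbT.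
Qed.

Lemma inf_mean_mono j k : (1 <= j <= k)%N -> inf_mean P (F k) <= inf_mean P (F j).
Proof.
move=> jk; have /andP[j1 jk'] := jk; have k1 := leq_trans j1 jk'.
apply: (inf_mean_ge (F0 j1)) => f Fjf.
by apply: (inf_mean_le P (F01 k1)); exact: class_mono jk f Fjf.
Qed.

Lemma inf_mean_all_le k : (1 <= k)%N -> inf_mean_all P F <= inf_mean P (F k).
Proof.
move=> k1; apply: ge_inf; last by exists k.
exists 0 => _ [j j1 <-].
by have /andP[] := inf_mean01 P (F0 j1) (F01 j1).
Qed.

Lemma inf_emp_meanE k w : (1 <= k)%N ->
  inf_emp_mean X (F k) w = emp_mean X w (fhat k w).
Proof.
move=> k1; have [Fk hk] := fhatP w k1; apply/eqP; rewrite eq_le; apply/andP; split.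
  apply: ge_inf; last by exists (fhat k w).
  by exists (emp_mean X w (fhat k w)) => _ [f Fkf <-]; exact: hk.
apply: lb_le_inf; first by exists (emp_mean X w (fhat k w)), (fhat k w).
by move=> _ [f Fkf <-]; exact: hk.
Qed.

Let dbar k := delta_bar P Pr q X rho (F k) (t k).

(** The first class alone gives a lower bound, and it enters every running maximum, so the bound is
    uniform in k. *)
Lemma dbar_ge : exists2 c : R, 0 < c &
  forall k, (1 <= k)%N -> (c%:E <= max_upto dbar k)%E.
Proof.
have [J hJ] := level_le_dbar (P := P) Pr X (rho := rho) (F0 (leqnn 1))
  (F01 (leqnn 1)) hrho q1 n0 (t0 (leqnn 1)).
exists (q ^- J); first by rewrite invr_gt0 exprn_gt0.
by move=> k k1; apply: le_trans hJ _; apply: (@le_max_upto _ dbar).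
Qed.

Lemma ex_kbar : exists k0, kbar P F 1 (max_upto dbar) = Some k0.
Proof.
have [c c0 hc] := dbar_ge.
have [k [k1 hk]] := @ex_no_drop _ (fun k => inf_mean P (F k)) (max_upto dbar) c c0
  (fun k k1 => inf_mean01 P (F0 k1) (F01 k1)) hc.
by apply: (@index_inf_ex _ k); split => // l kl; rewrite mul1e; exact: hk.
Qed.

Variables (dhat : nat -> Omega -> \bar R) (dtilde : nat -> \bar R) (w : Omega).
Hypothesis good : forall k, (1 <= k)%N ->
  [/\ ratio_event P Pr X rho (F k) q (t k) w, (dbar k <= dhat k w)%E &
      (dhat k w <= dtilde k)%E].

Local Notation Db := (max_upto dbar).
Local Notation Dh := (max_upto (fun j => dhat j w)).
Local Notation Dt := (max_upto dtilde).

Let DbDh k : (Db k <= Dh k)%E.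
Proof. by apply: max_upto_mono => j /andP[j1 _]; have [] := good j1. Qed.

Let DhDt k : (Dh k <= Dt k)%E.
Proof. by apply: max_upto_mono => j /andP[j1 _]; have [] := good j1. Qed.

(** A near-minimizer in F k0 has true excess in F l at most Db l up to e / 2, so [emp_excess_le]
    bounds its empirical excess by twice that. This is why the constant 1 for true risks becomes 2
    for empirical ones. *)
Lemma kbar_admissible k0 : (1 <= k0)%N ->
  (forall l, (k0 < l)%N -> ((inf_mean P (F k0) - inf_mean P (F l))%:E <= Db l)%E) ->
  forall l, (k0 < l)%N ->
    ((inf_emp_mean X (F k0) w - inf_emp_mean X (F l) w)%:E <= 2%:E * Dh l)%E.
Proof.
move=> k01 hk0 l kl; have l1 := leq_ltn_trans (leq0n k0) kl.
apply: (@le_trans _ _ (2%:E * Db l)%E); last exact: lee_wpmul2l.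
have [c c0 hc] := dbar_ge; have := hk0 l kl; have := hc l l1.
case E : (Db l) => [m| |] //; last by move=> _ _; rewrite mulry gtr0_sg// mul1e leey.
rewrite -EFinM !lee_fin => cm hm; have m0 := lt_le_trans c0 cm.
have [hr _ _] := good l1.
have [Fl hl] := fhatP w l1.
rewrite !inf_emp_meanE//; apply/ler_addgt0Pr => e e0.
have e20 : 0 < e / 2 by rewrite divr_gt0.
have [f Ff hf] := inf_mean_adherent P (F0 k01) (F01 k01) e20.
have Flf : F l f by apply: (@class_mono k0) Ff; rewrite k01 ltnW.
have dm : (dbar l <= (m + e / 2)%:E)%E.
  apply: le_trans (_ : m%:E <= _)%E; last by rewrite lee_fin lerDl ltW.
  by rewrite -E; apply: le_max_upto; rewrite l1 leqnn.
have := emp_excess_le (F0 l1) (F01 l1) hrho q1 n0 (t0 l1) hr Fl hl Flf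
  (addr_gt0 m0 e20) dm.
have -> : mean P f - inf_mean P (F l) <= m + e / 2 by lra.
have [_ /(_ f Ff)] := fhatP w k01.
by move=> h1 /(_ isT) h2; lra.
Qed.

(** The numerator is the constant in [khat], the denominator the loss in [excess_le]. *)
Let C' := 2 / (1 - q ^- 2).

Let q2 : 0 < 1 - q ^- 2.
Proof. by rewrite subr_gt0 invf_lt1 ?exprn_gt0// exprn_egt1. Qed.

(** Either the excess in F k is at most Dt k, which suffices since C' >= 1, or it exceeds [dbar k]
    and [excess_le] applies. The empirical excess is then at most 2 Dh k by the definition of
    [khat], whose value is at most k0 and hence at most k. *)
Lemma selected_excess_le k0 k : (1 <= k0)%N -> (k0 <= k)%N ->
  (forall l, (k0 < l)%N -> ((inf_mean P (F k0) - inf_mean P (F l))%:E <= Db l)%E) ->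
  ((mean P (selected fhat (khat F X 2 (fun k w => max_upto (fun j => dhat j w) k)) w)
    - inf_mean P (F k))%:E <= C'%:E * Dt k)%E.
Proof.
move=> k01 k0k hk0; have k1 := leq_trans k01 k0k.
set K := khat F X 2 _.
have Ak0 : [set k | (1 <= k)%N /\ forall l, (k < l)%N ->
    ((inf_emp_mean X (F k) w - inf_emp_mean X (F l) w)%:E <= 2%:E * Dh l)%E] k0.
  by split => //; exact: kbar_admissible.
have [h Kh] := index_inf_ex Ak0.
have [[h1 hh] hmin] := index_infP Kh.
have hk : (h <= k)%N by apply: leq_trans (hmin _ Ak0) k0k.
have -> : selected fhat K w = fhat h w by rewrite /selected /K /khat Kh.
set f := fhat h w.
have [Fhf _] := fhatP w h1.
have Fkf : F k f by apply: (@class_mono h) Fhf; rewrite h1.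
have [hr dk _] := good k1; have [Fk hFk] := fhatP w k1.
have [c c0 hc] := dbar_ge.
have dkm : (dbar k <= Db k)%E by apply: le_max_upto; rewrite k1 leqnn.
have C0 : 0 < C' by rewrite divr_gt0.
have C1 : 1 <= C'.
  by rewrite ler_pdivlMr// mul1r; have := invr_gt0 (q ^+ 2); rewrite exprn_gt0// => ?; lra.
have := le_trans (DbDh k) (DhDt k); have := hc k k1.
have := DhDt k.
case E : (Dt k) => [s| |] //.
- move=> Dhs cD Ds; rewrite -EFinM lee_fin.
  have s0 : 0 < s by rewrite (lt_le_trans c0)// -lee_fin (le_trans cD).
  have [es|es] := leP (mean P f - inf_mean P (F k)) s.
    by apply: le_trans es _; rewrite ler_peMl// ltW.
  have De : (dbar k < (mean P f - inf_mean P (F k))%:E)%E.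
    by apply: le_lt_trans (le_trans dkm Ds) _; rewrite lte_fin.
  have := excess_le (F0 k1) (F01 k1) hrho q1 n0 (t0 k1) hr hFk Fkf De.
  rewrite -ler_pdivlMr// => /le_trans; apply.
  rewrite /C' mulrAC ler_wpM2r ?invr_ge0 ?(ltW q2)//.
  move: hk; rewrite leq_eqVlt => /predU1P[hk|hk].
    by rewrite /f hk subrr mulr_ge0// ltW.
  have := hh k hk; rewrite !inf_emp_meanE// => /le_trans.
  rewrite -lee_fin; apply; rewrite EFinM; exact: lee_wpmul2l.
- by move=> _ _ _; rewrite mulry gtr0_sg// mul1e leey.
- by move=> _ h2 /(le_trans h2).
Qed.

End ModelSelection.

(* mu_ext Pr is the outer measure of Pr; it agrees with Pr on measurable
   events. *)
Theorem theorem7 (R : realType) (q : R) (q_gt1 : 1 < q) :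
  exists cbar chat C : R, [/\ 0 < cbar, 0 < chat & 0 < C] /\
  forall (d d' : measure_display)
    (S : measurableType d) (P : probability S R)
    (Omega : measurableType d') (Pr : probability Omega R)
    (n : nat) (X : 'I_n -> {mfun Omega >-> S})
    (rho : (S -> R) -> (S -> R) -> R)
    (FF : set (S -> R)) (F : nat -> set (S -> R))
    (fhat : nat -> Omega -> S -> R)
    (t p : nat -> R)
    (dhat : nat -> Omega -> \bar R) (dtilde : nat -> \bar R),
  (0 < n)%N ->
  iid_sample P Pr X ->
  dominates_variance P rho ->
  (forall f, FF f -> measurable_fun [set: S] f /\ forall x, 0 <= f x <= 1) ->
  (forall k, (1 <= k)%N -> F k `<=` F k.+1) ->
  (forall k, (1 <= k)%N -> F k `<=` FF) ->
  (forall k delta, (1 <= k)%N -> 0 < delta ->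
     measurable_suprema P n (near_min P (F k) delta)) ->
  (forall k w, (1 <= k)%N -> F k (fhat k w) /\
     forall f, F k f -> emp_mean X w (fhat k w) <= emp_mean X w f) ->
  (forall k, (1 <= k)%N -> 0 < t k) ->
  (forall k, (1 <= k)%N -> measurable_fun [set: Omega] (dhat k)) ->
  let dbar k := delta_bar P Pr q X rho (F k) (t k) in
  (forall k, (1 <= k)%N ->
     ((1 - p k)%:E <=
      Pr [set w | (dbar k <= dhat k w)%E /\ (dhat k w <= dtilde k)%E])%E) ->
  let fsel := selected fhat
    (khat F X chat (fun k w => max_upto (fun j => dhat j w) k)) in
  let excess w := (mean P (fsel w) - inf_mean_all P F)%:E in
  (mu_ext Pr [set w |
     (oracle_bound P F (kbar P F cbar (max_upto dbar)) C (max_upto dtilde)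
      <= excess w)%E]
   <= failure_bound q n p t)%E /\
  (forall k, kstar P F = Some k ->
    (mu_ext Pr [set w | (C%:E * max_upto dtilde k <= excess w)%E]
     <= failure_bound q n p t)%E).
Proof.
have q2 : 0 < 1 - q ^- 2.
  by rewrite subr_gt0 invf_lt1 ?exprn_gt0 ?exprn_egt1// (lt_trans ltr01).
pose C' := 2 / (1 - q ^- 2); have C'0 : 0 < C' by rewrite divr_gt0.
(* C is twice the constant of [selected_excess_le]: the spare half is bounded below by a positive
   number and yields strict inequalities. *)
exists 1, 2, (2 * C'); split; first by split => //; rewrite mulr_gt0.
move=> d d' S P Omega Pr n X rho FF F fhat t p dhat dtilde n0 iX hrho FF01 FS FFF mF
  fhatP t0 mdhat dbar hp fsel excess.
have F01 k : (1 <= k)%N -> forall f, F k f ->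
    measurable_fun [set: S] f /\ forall x, 0 <= f x <= 1.
  by move=> k1 f /(FFF k k1)/FF01.
have F0 k : (1 <= k)%N -> F k !=set0.
  move=> k1; have [w _] := probability_nonempty Pr.
  by exists (fhat k w); have [] := fhatP k w k1.
pose A k := [set w | (dbar k <= dhat k w)%E /\ (dhat k w <= dtilde k)%E].
have mA k : (1 <= k)%N -> measurable (A k).
  move=> k1; have := mdhat k k1 measurableT.
  move=> /(_ [set x | (dbar k <= x <= dtilde k)%E]).
  rewrite setTI (_ : _ @^-1` _ = A k); last first.
    by apply/seteqP; split => w /=; [move=> /andP[]|move=> [-> ->]].
  apply; rewrite (_ : [set x | _] = `[dbar k, dtilde k]%classic).
    exact: emeasurable_itv.
  by apply/seteqP; split => x /=; rewrite in_itv.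
pose r k := Num.max (ln (q ^+ 2 * n%:R / t k) / ln q) 0 * expR (- t k).
have /choice[bad hbad] k : exists B, [/\ measurable B,
    (1 <= k)%N -> (Pr B <= (p k + r k)%:E)%E &
    forall w, (1 <= k)%N -> ~ B w ->
      ratio_event P Pr X rho (F k) q (t k) w /\ A k w].
  (* Index 0 is not a class; the empty set fills its place in the sequence. *)
  have [->|k1] := posnP k; first by exists set0; split.
  have [B [mB PB hB]] := ratio_event_tail (F0 k k1) (F01 k k1) hrho q_gt1
    n0 (t0 k k1) iX (fun delta => mF k delta k1).
  exists (B `|` ~` A k); split.
  - by apply: measurableU => //; apply: measurableC; exact: mA.
  - move=> _; apply: le_trans (measureU2 _ _ _) _ => //.
      by apply: measurableC; exact: mA.
    rewrite addeC EFinD; apply: leeD => //.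
    apply: (@le_trans _ _ (1 - Pr (A k))%E).
      by rewrite -probability_setC//; exact: mA.
    rewrite leeBlDr ?fin_num_measure//; last exact: mA.
    by rewrite -leeBlDl// -EFinB; exact: hp.
  - move=> w _ /not_orP[nB /contrapT Aw]; split => //; exact: hB.
(* An event that no good outcome enters lies in the union of the bad sets. Outer measure and
   countable subadditivity then apply whether or not E is measurable. *)
have bound (E : set Omega) :
    (forall w, (forall k, (1 <= k)%N -> [/\ ratio_event P Pr X rho (F k) q (t k) w,
       (dbar k <= dhat k w)%E & (dhat k w <= dtilde k)%E]) -> ~ E w) ->
    (mu_ext Pr E <= failure_bound q n p t)%E.
  move=> hE; pose U := \bigcup_(k in ~` `I_1) bad k.
  have mU : measurable U by apply: bigcup_measurable => k _; have [] := hbad k.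
  apply: (@le_trans _ _ (mu_ext Pr U)).
    apply: le_mu_ext => w Ew; apply: contrapT => nU; apply: (hE w _ Ew) => k k1.
    have [_ _ /(_ w k1)[|rk [? ?]]] := hbad k; last by split.
    by move=> bk; apply: nU; exists k => //=; apply/negP; rewrite -leqNgt.
  rewrite measurable_mu_extE//.
  have mbad k : measurable (bad k) by have [] := hbad k.
  apply: le_trans (measure_sigma_subadditive_tail Pr mbad mU (@subset_refl _ _)) _.
  rewrite /failure_bound [leLHS]eseries_cond [leRHS]eseries_cond.
  by apply: lee_nneseries => // k /andP[_ k1]; have [_ + _] := hbad k; exact.
have [k0 Hk0] := ex_kbar Pr X q_gt1 n0 hrho F01 F0 t0.
have [[k01 hk0] k0min] := index_infP Hk0.
have {}hk0 l : (k0 < l)%N ->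
    ((inf_mean P (F k0) - inf_mean P (F l))%:E <= max_upto dbar l)%E.
  by move=> /hk0; rewrite mul1e.
have [c c0 hc] := dbar_ge Pr X q_gt1 n0 hrho F01 F0 t0.
have cDt w k : (1 <= k)%N -> (forall k, (1 <= k)%N ->
    [/\ ratio_event P Pr X rho (F k) q (t k) w,
       (dbar k <= dhat k w)%E & (dhat k w <= dtilde k)%E]) ->
    (c%:E <= max_upto dtilde k)%E.
  move=> k1 good; apply: le_trans (hc k k1) _.
  apply: max_upto_mono => j /andP[j1 _]; have [_ h1 h2] := good j j1.
  exact: le_trans h2.
(* One half of 2 C' Dt k bounds the excess within F k, the other half pays for the margin C' c. *)
have key w k : (k0 <= k)%N -> (forall k, (1 <= k)%N ->
    [/\ ratio_event P Pr X rho (F k) q (t k) w,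
       (dbar k <= dhat k w)%E & (dhat k w <= dtilde k)%E]) ->
  (excess w + (C' * c)%:E <=
   (inf_mean P (F k) - inf_mean_all P F)%:E + (2 * C')%:E * max_upto dtilde k)%E.
  move=> k0k good; have k1 := leq_trans k01 k0k.
  have := selected_excess_le q_gt1 n0 hrho F01 F0 FS fhatP t0 good k01 k0k hk0.
  have := cDt w k k1 good; rewrite /excess -/C' -/(fsel w).
  case: (max_upto dtilde k) => [s| |] //; last first.
    by move=> _ _; rewrite mulry gtr0_sg; [rewrite mul1e addey// leey|rewrite mulr_gt0].
  rewrite -!EFinM -!EFinD !lee_fin => cs h.
  by have := ler_wpM2l (ltW C'0) cs; lra.
have gap w : ~ (excess w + (C' * c)%:E <= excess w)%E.
  by rewrite /excess -EFinD lee_fin gerDl; apply/negP; rewrite -ltNge mulr_gt0.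
split.
  apply: bound => w good; rewrite Hk0 /= => h; apply: (gap w); apply: le_trans h.
  by apply: le_ereal_inf_tmp => _ [k k0k <-]; exact: key.
move=> k Hk; have [[k1 hk] _] := index_infP Hk.
(* From [kstar] on the differences of infima are 0, so [kstar] satisfies the condition defining
   [kbar]. *)
have k0k : (k0 <= k)%N.
  apply: k0min; split => // l kl; rewrite (hk l kl) subrr mul1e.
  by apply: le_trans (hc l (leq_ltn_trans (leq0n k) kl)); rewrite lee_fin ltW.
(* Earlier classes have larger infima by inclusion, later ones the same infimum, so the overall
   infimum is reached at k. *)
have infE : inf_mean P (F k) - inf_mean_all P F = 0.
  apply/eqP; rewrite subr_eq0 eq_le (inf_mean_all_le P F01 F0 k1) andbT.
  apply: lb_le_inf; first by exists (inf_mean P (F k)), k.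
  move=> _ [j j1 <-]; have [jk|kj] := leqP j k; last by rewrite (hk j kj).
  by apply: (inf_mean_mono P F01 F0 FS); rewrite j1.
apply: bound => w good h; apply: (gap w); apply: le_trans h.
by have := key w k k0k good; rewrite infE add0e.
Qed.
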